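(* Let $S_{0,4}$ be the compact oriented planar surface with four boundary components, and let $\lambda,\mu$ be oriented simple closed curves, each dividing $S_{0,4}$ into two pairs of pants, that intersect in precisely two points; let $\alpha,\beta$ be the oriented curves obtained from $\lambda,\mu$ by resolving both crossings compatibly with the orientations (see context). Let $\rho_0\colon\pi_1(S_{0,4})\to\mathrm{SL}_2(\mathbb C)$ be a good, $\partial$-regular representation such that $t_{\lambda\mu}(\rho_0)\ne t_{\alpha\beta}(\rho_0)$. Then: (1) the map $T=(t_\lambda,t_\mu)\colon\mathcal R^*(S_{0,4},\partial S_{0,4},\mathrm{SL}_2(\mathbb C))_{\rho_0}\setminus\{t_{\lambda\mu}=t_{\alpha\beta}\}\to\mathbb C^2$ is a local parameterization; (2) the symplectic form on $\mathcal R^*(S_{0,4},\partial S_{0,4},\mathrm{SL}_2(\mathbb C))_{\rho_0}\setminus\{t_{\lambda\mu}=t_{\alpha\beta}\}$ is $$\omega=\pm\frac{dt_\lambda\wedge dt_\mu}{t_{\lambda\mu}-t_{\alpha\beta}} .$$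
   Context: The base point is one of the two intersection points of $\lambda$ and $\mu$. $\pi_1(S_{0,4})$ is free on $\gamma_1,\gamma_2,\gamma_3$, where $\gamma_1,\gamma_2,\gamma_3,\gamma_1\gamma_2\gamma_3$ represent the four peripheral curves, and the generators can be chosen so that, for suitable orientations, $\lambda=\gamma_1\gamma_2$, $\mu=\gamma_2\gamma_3$; with these orientations $\alpha=\gamma_1\gamma_2\gamma_3$ and $\beta=\gamma_2$, so $t_{\lambda\mu}-t_{\alpha\beta}=\operatorname{tr}\rho(\gamma_1\gamma_2\gamma_2\gamma_3)-\operatorname{tr}\rho(\gamma_1\gamma_2\gamma_3\gamma_2)$. If the orientation of $\mu$ is reversed, $\mu=\gamma_3^{-1}\gamma_2^{-1}$, $\alpha=\gamma_1$, $\beta=\gamma_3^{-1}$. Up to sign $t_{\lambda\mu}-t_{\alpha\beta}$ does not depend on the orientations. Here $t_\gamma$ is the trace function $[\rho]\mapsto\operatorname{tr}\rho(\gamma)$. A representation $\rho\colon\pi_1(S)\to\mathrm{SL}_2(\mathbb C)$ is good if its image is contained in no proper parabolic subgroup (i.e. it is irreducible) and its centralizer is the center. It is $\partial$-regular if each peripheral element is mapped to a regular element (in $\mathrm{SL}_2(\mathbb C)$: an element $\ne\pm\mathrm{Id}$). $\mathcal R^*(S,\partial S,\mathrm{SL}_2(\mathbb C))_{\rho_0}$ is the set of conjugacy classes $[\rho]$ of good representations such that, for every boundary component $\partial_i$, $\rho(\partial_i)$ is conjugate to $\rho_0(\partial_i)$. It is a complex manifold with tangent space at $[\rho]$ equal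 to $\ker\big(H^1(S;\operatorname{Ad}\rho)\to H^1(\partial S;\operatorname{Ad}\rho)\big)$ (a path $\rho_s$ corresponds to the class of $\gamma\mapsto\frac{d}{ds}\rho_s(\gamma)\rho(\gamma)^{-1}|_{s=0}$). A local parameterization is a holomorphic map that is a local biholomorphism at every point. The (Atiyah–Bott–Goldman) symplectic form: with $\mathcal B(X,Y)=-\operatorname{tr}(XY)$ on $\mathfrak{sl}_2(\mathbb C)$, for $a,b$ in this kernel, $\omega(a,b)=\langle\widetilde a,b\rangle$, where $\widetilde a\in H^1(S,\partial S;\operatorname{Ad}\rho)$ maps to $a$ and $\langle\cdot,\cdot\rangle\colon H^1(S,\partial S;\operatorname{Ad}\rho)\times H^1(S;\operatorname{Ad}\rho)\to\mathbb C$ is the Poincaré duality pairing (cup product, $\mathcal B$ on coefficients, evaluation on the fundamental class). *)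

(* Defs.v *)
From HB Require Import structures.
From mathcomp Require Import all_boot all_order all_algebra.
From mathcomp Require Import complex.
From mathcomp Require Import all_classical all_reals all_analysis.

Set Implicit Arguments.
Unset Strict Implicit.
Unset Printing Implicit Defensive.

Import Order.TTheory GRing.Theory Num.Theory.
Import numFieldNormedType.Exports.

Local Open Scope classical_set_scope.
Local Open Scope ring_scope.

(* Free groups as reduced words in the letters (t, false) = t and
   (t, true) = t^-1. *)

Section FreeGroup.
Context (T : choiceType).
Implicit Types (a b : T * bool) (w x y z : seq (T * bool)).

Definition linv a : T * bool := (a.1, ~~ a.2).

Definition reduced w : bool := sorted (fun a b => b != linv a) w.

Definition push a w :=
  if w is b :: w' then if b == linv a then w' else a :: w else [:: a].

(* Reduced form of x ++ y, for y reduced. *)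
Definition wmul x y := foldr push y x.

Definition winv w := rev (map linv w).

Lemma linvK : involutive linv.
Proof. by case=> t b; rewrite /linv /= negbK. Qed.

Lemma push_reduced a w : reduced w -> reduced (push a w).
Proof.
case: w => [//|b w]; rewrite /push; case: ifP => [_|/negbT ba] rw.
  exact: path_sorted rw.
by rewrite /reduced /= ba.
Qed.

Lemma wmul_reduced x y : reduced y -> reduced (wmul x y).
Proof. by move=> ry; elim: x => //= a x; exact: push_reduced. Qed.

Lemma push_linvK a w : reduced w -> push a (push (linv a) w) = w.
Proof.
case: w => [|b w] rw; first by rewrite /= eqxx.
rewrite [push (linv a) _]/= linvK; case: eqP rw => [->|_ _].
  by case: w => [//|c w] /andP[/negPf /= -> _].
by rewrite /= eqxx.
Qed.

Lemma wmul_push a w z : reduced w -> reduced z ->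
  wmul (push a w) z = push a (wmul w z).
Proof.
case: w => [//|b w] rw rz /=; case: ifP => [/eqP ->|//].
by rewrite push_linvK//; exact: wmul_reduced.
Qed.

Lemma wmulA x y z : reduced y -> reduced z ->
  wmul x (wmul y z) = wmul (wmul x y) z.
Proof.
move=> ry rz; elim: x => //= a x ->.
by rewrite wmul_push//; exact: wmul_reduced.
Qed.

Lemma wmul1 x : reduced x -> wmul x [::] = x.
Proof.
elim: x => //= a x IH rx; rewrite IH; last exact: path_sorted rx.
by case: x rx {IH} => //= b x /andP[/negPf -> _].
Qed.

Lemma wmulV x : wmul (winv x) x = [::].
Proof.
elim: x => //= a x IH; rewrite /winv /= rev_cons /wmul foldr_rcons /=.
by rewrite linvK eqxx.
Qed.

Lemma winvK : involutive winv.
Proof.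
by move=> w; rewrite /winv map_rev revK -map_comp map_id_in// => a _; exact: linvK.
Qed.

Lemma winv_reduced w : reduced w -> reduced (winv w).
Proof.
rewrite /reduced /winv rev_sorted sorted_map; apply: sub_sorted => a b /=.
by rewrite linvK eq_sym.
Qed.

Definition freegroup := {w : seq (T * bool) | reduced w}.

HB.instance Definition _ := Choice.on freegroup.

Implicit Types u v : freegroup.

Definition fg_one : freegroup := Sub [::] isT.
Definition fg_mul u v : freegroup :=
  Sub (wmul (val u) (val v)) (wmul_reduced (val u) (valP v)).
Definition fg_inv u : freegroup := Sub (winv (val u)) (winv_reduced (valP u)).
Definition fg_gen (t : T) : freegroup := Sub [:: (t, false)] isT.

Fact fg_mulA : associative fg_mul.
Proof. by move=> u v w; apply/val_inj/wmulA; apply: valP. Qed.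
Fact fg_mul1g : left_id fg_one fg_mul.
Proof. by move=> u; apply/val_inj. Qed.
Fact fg_mulg1 : right_id fg_one fg_mul.
Proof. by move=> u; apply/val_inj/wmul1; exact: valP. Qed.
Fact fg_mulVg : left_inverse fg_one fg_inv fg_mul.
Proof. by move=> u; apply/val_inj/wmulV. Qed.
Fact fg_mulgV : right_inverse fg_one fg_inv fg_mul.
Proof. by move=> u; apply/val_inj; rewrite /= -{1}(winvK (val u)) wmulV. Qed.

HB.instance Definition _ := isGroup.Build freegroup
  fg_mulA fg_mul1g fg_mulg1 fg_mulVg fg_mulgV.

End FreeGroup.

(* The fundamental group of the four-holed sphere S_{0,4}, based at one of the
   two intersection points of the curves lambda and mu, is free on three
   generators; they and their product are the four peripheral elements. *)
Definition pi1 : groupType := freegroup 'I_3.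

Definition gamma1 : pi1 := fg_gen (inord 0 : 'I_3).
Definition gamma2 : pi1 := fg_gen (inord 1 : 'I_3).
Definition gamma3 : pi1 := fg_gen (inord 2 : 'I_3).

Definition bdry (i : 'I_4) : pi1 :=
  nth 1%g [:: gamma1; gamma2; gamma3; (gamma1 * gamma2 * gamma3)%g] i.

(* The curves lambda and mu; the flag ol (resp. om) tells whether the
   orientation of lambda (resp. mu) is reversed. *)
Definition lam (ol : bool) : pi1 :=
  let l := (gamma1 * gamma2)%g in if ol then l^-1%g else l.
Definition mu (om : bool) : pi1 :=
  let m := (gamma2 * gamma3)%g in if om then m^-1%g else m.

(* The two intersection points cut lambda and mu into arcs, lambda = l1 l2 and
   mu = m1 m2, and the resolved curves are alpha = l1 m2 and beta = m1 l2.
   In the standard orientation l1 m2 = gamma1 gamma2 gamma3 and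
   m1 l2 = gamma2.  Reversing lambda replaces (l1, l2) by (l2^-1, l1^-1),
   and likewise for mu, which gives the other three cases. *)
Definition alpha (ol om : bool) : pi1 :=
  match ol, om with
  | false, false => gamma1 * gamma2 * gamma3
  | false, true => gamma1
  | true, false => gamma3
  | true, true => gamma2^-1
  end%g.
Definition beta (ol om : bool) : pi1 :=
  match ol, om with
  | false, false => gamma2
  | false, true => gamma3^-1
  | true, false => gamma1^-1
  | true, true => (gamma1 * gamma2 * gamma3)^-1
  end%g.

(* Typing C as a numClosedFieldType gives it (and matrices over it) the topology
   and norm of the library. *)
Definition Cx (R : realType) : numClosedFieldType := R[i].

Section CharacterVariety.
Context (R : realType).
Local Notation C := (Cx R).
Local Notation M2 := 'M[C]_2.

(* All functions from pi1 to M_2(C), with the topology of pointwise convergence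
   (on representations: that of the images of the generators). *)
Definition rep := {ptws pi1 -> 'M[Cx R]_2}.

Implicit Types (rho : rep) (g h : pi1) (A B X Y : M2).

Definition is_rep rho : Prop :=
  (forall g, \det (rho g) = 1) /\ (forall g h, rho (g * h)%g = rho g *m rho h).

Definition proper_parabolic (P : set M2) : Prop :=
  exists2 v : 'cV[C]_2, v != 0 &
    P = [set A | \det A = 1 /\ exists a : C, A *m v = a *: v].

Definition irreducible rho : Prop :=
  ~ exists2 P, proper_parabolic P & forall g, P (rho g).

Definition SL2_center : set M2 :=
  [set A | \det A = 1 /\ forall B, \det B = 1 -> A *m B = B *m A].

Definition centralizer rho : set M2 :=
  [set A | \det A = 1 /\ forall g, A *m rho g = rho g *m A].

Definition good rho : Prop :=
  [/\ is_rep rho, irreducible rho & centralizer rho = SL2_center].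

Definition regular_elt A : Prop := A <> 1%:M /\ A <> - 1%:M.

Definition bdry_regular rho : Prop := forall i, regular_elt (rho (bdry i)).

Definition SL2_conj A B : Prop :=
  exists2 P : M2, \det P = 1 & B = P *m A *m invmx P.

Definition conj_class rho : set rep :=
  [set rho' | exists2 P : M2, \det P = 1 &
                forall g, rho' g = P *m rho g *m invmx P].

(* R^* is the set of conjugacy classes of elements of Hom^*. *)
Definition Homstar (rho0 : rep) : set rep :=
  [set rho | good rho /\ forall i, SL2_conj (rho0 (bdry i)) (rho (bdry i))].

Definition Rstar (rho0 : rep) : set (set rep) := conj_class @` Homstar rho0.

(* The trace function t_g, read off on any representative (see trfunE). *)
Definition trfun g (c : set rep) : C := \tr (xget (cst 0 : rep) c g).

Lemma conj_class_refl rho : conj_class rho rho.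
Proof.
by exists 1%:M => [|g]; rewrite ?det1// invmx1 mul1mx mulmx1.
Qed.

Lemma trfunE g rho : trfun g (conj_class rho) = \tr (rho g).
Proof.
rewrite /trfun; have [P dP ->] := xgetI (cst 0 : rep) (conj_class_refl rho).
rewrite mxtrace_mulC mulmxA mulVmx ?mul1mx//.
by rewrite unitmxE dP unitr1.
Qed.

(* The complex manifold R^* is the quotient by conjugation of Hom^*, a complex
   submanifold of M_2(C)^3 (images of the generators), and the projection has
   local holomorphic sections.  So U is open in R^* iff its preimage is open in
   Hom^*, a map from an open subset of C^n to R^* is holomorphic iff it lifts
   locally to a holomorphic map to Hom^*, and a function on R^* is holomorphic
   iff its composite with every such map is. *)

Definition Rstar_open (rho0 : rep) (U : set (set rep)) : Prop :=
  U `<=` Rstar rho0 /\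
  exists2 O : set rep, open O &
    forall rho, Homstar rho0 rho -> U (conj_class rho) <-> O rho.

Definition holo_to_Rstar (rho0 : rep) n (V : set 'rV[C]_n.+1)
    (f : 'rV[C]_n.+1 -> set rep) : Prop :=
  forall v, V v -> exists (W : set 'rV[C]_n.+1) (p : 'rV[C]_n.+1 -> rep),
    [/\ open W, W v &
     forall w, V w -> W w ->
       [/\ Homstar rho0 (p w), conj_class (p w) = f w &
        forall g, differentiable (fun w' => p w' g) w]].

Definition holo_on_Rstar (rho0 : rep) m (U : set (set rep))
    (F : set rep -> 'rV[C]_m.+1) : Prop :=
  forall n (V : set 'rV[C]_n.+1) (f : 'rV[C]_n.+1 -> set rep),
    open V -> holo_to_Rstar rho0 V f -> (forall v, V v -> U (f v)) ->
    forall v, V v -> differentiable (F \o f) v.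

Definition local_biholo_at (rho0 : rep) m (X : set (set rep))
    (F : set rep -> 'rV[C]_m.+1) (x : set rep) : Prop :=
  exists (U : set (set rep)) (G : 'rV[C]_m.+1 -> set rep),
    [/\ Rstar_open rho0 U, U x & U `<=` X] /\
    [/\ open (F @` U), holo_on_Rstar rho0 U F,
        holo_to_Rstar rho0 (F @` U) G & forall y, U y -> G (F y) = y].

Definition local_parameterization (rho0 : rep) m (X : set (set rep))
    (F : set rep -> 'rV[C]_m.+1) : Prop :=
  holo_on_Rstar rho0 X F /\ forall x, X x -> local_biholo_at rho0 X F x.

Definition trpair g h (c : set rep) : 'rV[C]_2 :=
  \row_(j < 2) (if j == 0 then trfun g c else trfun h c).

(* Cohomology of pi1 with coefficients in sl_2(C) twisted by Ad rho is computed
   with inhomogeneous (bar) cochains. *)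

Definition Ad rho g X : M2 := rho g *m X *m invmx (rho g).

Definition Z1 rho (u : pi1 -> M2) : Prop :=
  (forall g, \tr (u g) = 0) /\
  (forall g h, u (g * h)%g = u g + Ad rho g (u h)).

Definition cobound rho X g : M2 := Ad rho g X - X.

Definition cohomologous rho (u u' : pi1 -> M2) : Prop :=
  exists2 X, \tr X = 0 & forall g, u' g = u g + cobound rho X g.

Definition bdry_group (i : 'I_4) : set pi1 :=
  [set g | exists n : nat, (g = bdry i ^+ n)%g \/ (g = bdry i ^- n)%g].

(* u represents a class in the kernel of H^1(S; Ad rho) -> H^1(dS; Ad rho),
   i.e. a tangent vector of R^* at the class of rho: the velocity of a path
   rho_s at rho is u g = (d/ds rho_s(g)) rho(g)^-1. *)
Definition tangent rho (u : pi1 -> M2) : Prop :=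
  Z1 rho u /\
  forall i, exists2 X, \tr X = 0 &
    forall g, bdry_group i g -> u g = cobound rho X g.

(* Relative 1-cocycles, in the mapping cone of the restriction from pi1 to the
   peripheral subgroups: (u, xi) with u a 1-cocycle of pi1 and xi i a 0-cochain
   of the i-th peripheral subgroup whose coboundary is the restriction of u.
   The map H^1(S, dS) -> H^1(S) is (u, xi) |-> u. *)
Definition Z1rel rho (a : (pi1 -> M2) * ('I_4 -> M2)) : Prop :=
  Z1 rho a.1 /\
  forall i, \tr (a.2 i) = 0 /\
    forall g, bdry_group i g -> a.1 g = cobound rho (a.2 i) g.

Definition Bform X Y : C := - \tr (X *m Y).

(* The fundamental class of (S, dS): the relative 2-cycle consisting of the bar
   chain [gamma1|gamma2] + [gamma1 gamma2|gamma3] of pi1 and of the peripheral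
   1-chain which is its boundary, [gamma1] + [gamma2] + [gamma3] -
   [gamma1 gamma2 gamma3] (fund_boundary below).  It is the generator of
   H_2(S, dS; Z) = Z attached to one of the two orientations of S. *)
Definition fund2 : seq (pi1 * pi1) :=
  [:: (gamma1, gamma2); ((gamma1 * gamma2)%g, gamma3)].
Definition fund_sign (i : 'I_4) : int := if i == ord_max then -1 else 1.

Lemma fund_boundary (V : zmodType) (f : pi1 -> V) :
  \sum_(c <- fund2) (f c.2 - f (c.1 * c.2)%g + f c.1) =
  \sum_(i < 4) f (bdry i) *~ fund_sign i.
Proof.
rewrite !big_cons big_nil /= !big_ord_recl big_ord0 /fund_sign /bdry /=.
rewrite !mulr1z mulrN1z !addr0.
set a := f gamma1; set b := f gamma2; set c := f gamma3 - _.
by rewrite [b - _ + a]addrAC [b + a]addrC [c + _]addrC addrA subrK -addrA.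
Qed.

(* Evaluation on the fundamental class of the cup product of a relative and an
   absolute 1-cocycle.  The product is (u cup v, xi cup v) in the mapping cone,
   and a relative 2-cochain (w, eta) evaluates to w(c) - eta(dc). *)
Definition pairing rho (a : (pi1 -> M2) * ('I_4 -> M2)) (v : pi1 -> M2) : C :=
  \sum_(c <- fund2) Bform (a.1 c.1) (Ad rho c.1 (v c.2)) -
  \sum_(i < 4) Bform (a.2 i) (v (bdry i)) *~ fund_sign i.

Definition lifts rho (u : pi1 -> M2) : set ((pi1 -> M2) * ('I_4 -> M2)) :=
  [set a | Z1rel rho a /\ cohomologous rho u a.1].

(* omega(u, v) = <a, v> for a class a in H^1(S, dS; Ad rho) mapping to u. *)
Definition omega rho (u v : pi1 -> M2) : C :=
  pairing rho (xget (cst 0, cst 0) (lifts rho u)) v.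

(* Differential of t_g at the class of rho on the tangent vector u: derivative
   of the trace at rho g in the direction u g *m rho g of the velocity at g of
   a path tangent to u (see is_derive_trfun). *)
Definition dtr g rho (u : pi1 -> M2) : C :=
  'D_(u g *m rho g) (fun A : M2 => \tr A) (rho g).

Lemma is_derive_mxtrace (V : normedModType C) (f : V -> M2) (x v : V) (l : M2) :
  is_derive x v f l -> is_derive x v (fun y => \tr (f y) : C) (\tr l).
Proof.
move=> [df <-].
have ctr : continuous (fun A : M2 => \tr A : C).
  move=> A; rewrite /mxtrace; apply: (@cvg_big _ _ _ _ _ _ _ (nbhs A)) => [|i _].
    exact: add_continuous.
  exact: coord_continuous.
have dtr_f : s^-1 *: ((\tr (f (s *: v + x)) : C) - \tr (f x)) @[s --> 0^'] -->
    (\tr ('D_v f x) : C).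
  rewrite (_ : (fun s => _) =
    mxtrace \o (fun s : C => s^-1 *: ((f \o shift x) (s *: v) - f x))).
    exact: (cvg_comp _ _ (df : _ --> 'D_v f x) (ctr ('D_v f x))).
  by apply/funext => s /=; rewrite mxtraceZ [\tr (_ - _)]raddfB.
by split; [apply/cvg_ex; eexists; exact: dtr_f | exact: cvg_lim dtr_f].
Qed.

Lemma dtrE g rho u : dtr g rho u = \tr (u g *m rho g).
Proof.
by case: (is_derive_mxtrace (is_derive_id (rho g) (u g *m rho g))).
Qed.

Lemma is_derive_trfun (p : C -> rep) (u : pi1 -> M2) g :
  is_derive (0 : C) (1 : C) (fun s => p s g : M2) (u g *m p 0 g) ->
  is_derive (0 : C) (1 : C) (fun s => trfun g (conj_class (p s)))
    (dtr g (p 0) u).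
Proof.
move=> /is_derive_mxtrace dp; rewrite dtrE.
by rewrite (_ : (fun s => trfun _ _) = fun s => \tr (p s g))//;
  apply/funext => s; rewrite trfunE.
Qed.

End CharacterVariety.

(* Main.v *)
(* Let A, B, C be the images of the three generators and L = A B.  Up to sign,
   t_lm - t_ab is the triple product tr (L [B, C]), which is nonzero iff
   1, L, B, C is a basis of the 2x2 matrices.  The Gram matrix, for the trace
   form, of the traceless parts of (L, B, C) is a polynomial in the boundary
   traces and in (x, y) = (tr L, tr (B C)), and the square of the triple product
   is a constant times its determinant.  Since the adjoint action identifies
   PSL_2 with SO_3, the conjugacy class of the representation is determined by
   (x, y) and by the sign of the triple product; a Cholesky factorization of the
   Gram matrix, relative to its value at a base point, gives a holomorphic
   section.  The infinitesimal version (so_3 = ad sl_2) shows that a tangent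
   vector killed by dt_l and dt_m is zero.  Hence every tangent vector is a
   combination of the twist flows along lambda and mu, whose pairings with an
   arbitrary tangent vector are dt_l and - dt_m. *)

Require Import Defs.
From HB Require Import structures.
From mathcomp Require Import all_boot all_order all_algebra.
From mathcomp Require Import complex ring.
From mathcomp Require Import all_classical all_reals all_analysis.
Set Implicit Arguments.
Unset Strict Implicit.
Unset Printing Implicit Defensive.
Import Order.TTheory GRing.Theory Num.Theory.
Import numFieldNormedType.Exports.
Local Open Scope classical_set_scope.
Local Open Scope ring_scope.

(** * Matrices of size 2 in Pauli coordinates *)

(** The frame uses L = A B instead of A because the Gram matrix of (A, B, C) would involve tr (A C),
    which is not among the given data. With L, the product L C has the boundary trace d, tr (L B)
    reduces to b x - a, and A comes back as L B^-1.

    A Gram matrix sees a frame only up to the complex orthogonal group. So, where the triple product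
    is nonzero, at most two classes lie over (x, y), with opposite triple products, and the sign has
    to be followed everywhere.

    A complex symmetric matrix has no preferred factorization. Dividing by the base frame makes the
    Gram matrix the identity at the base point; the pivots then stay near 1, where a holomorphic
    root exists. The section is thus an explicit local inverse, and no Jacobian is computed.

    In SL_2 the trace fixes the conjugacy class of nonscalar elements only. At the boundary this
    comes from regularity for [rho0] and from the nonzero triple product for the section. *)

Section MatrixEntries.
Context (K : numClosedFieldType).
Implicit Types (A B C L M N P X Y Z : 'M[K]_2) (p q r t : K).

Lemma mx2P A B : A 0 0 = B 0 0 -> A 0 1 = B 0 1 -> A 1 0 = B 1 0 ->
  A 1 1 = B 1 1 -> A = B.
Proof.
move=> e00 e01 e10 e11; apply/matrixP => i j.
have I2 (k : 'I_2) : k = 0 \/ k = 1.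
  by case: k => [[|[|//]] hk]; [left|right]; apply/val_inj.
by case: (I2 i) => ->; case: (I2 j) => ->.
Qed.

Lemma mul2E m n (A : 'M[K]_(m, 2)) (B : 'M[K]_(2, n)) i j :
  (A *m B) i j = A i 0 * B 0 j + A i 1 * B 1 j.
Proof.
rewrite mxE !big_ord_recl big_ord0 addr0; congr (_ + A _ _ * B _ _);
  exact/val_inj.
Qed.

Lemma tr2E A : \tr A = A 0 0 + A 1 1.
Proof.
rewrite /mxtrace !big_ord_recl big_ord0 addr0; congr (_ + A _ _); exact/val_inj.
Qed.

Lemma scalar2E p i j : (p%:M : 'M[K]_2) i j = if i == j then p else 0.
Proof. by rewrite mxE; case: eqP. Qed.

Lemma det2E (T : comNzRingType) (A : 'M[T]_2) : \det A = A 0 0 * A 1 1 - A 0 1 * A 1 0.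
Proof.
rewrite (expand_det_row _ 0) !big_ord_recl big_ord0 addr0 /cofactor !det_mx11.
rewrite !mxE /= expr0 expr1 mul1r mulN1r mulrN.
by congr (A _ _ * A _ _ - A _ _ * A _ _); exact/val_inj.
Qed.

Definition mx2E := (mul2E, tr2E, scalar2E, det2E, mxE).

End MatrixEntries.

Ltac mx2ring := rewrite ?mx2E /=; ring.
Ltac mx2eq := apply: mx2P; mx2ring.

Section PauliCoordinates.
Context (K : numClosedFieldType).
Implicit Types (A B C L M N P X Y Z : 'M[K]_2) (p q r t : K).

(** The adjugate, by Cayley-Hamilton. It stands for the inverse on SL_2 and is polynomial in the
    entries, which suits both [ring] and differentiability. *)
Definition adj2 A : 'M[K]_2 := (\tr A)%:M - A.

Lemma mul_adj2 A : A *m adj2 A = (\det A)%:M.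
Proof. rewrite /adj2; mx2eq. Qed.

Lemma adj2_mul A : adj2 A *m A = (\det A)%:M.
Proof. rewrite /adj2; mx2eq. Qed.

Lemma det_adj2 A : \det (adj2 A) = \det A.
Proof. rewrite /adj2; mx2ring. Qed.

Lemma adj2M A B : adj2 (A *m B) = adj2 B *m adj2 A.
Proof. rewrite /adj2; mx2eq. Qed.

Lemma invmx_adj2 A : \det A = 1 -> invmx A = adj2 A.
Proof.
move=> dA; have uA : A \in unitmx by rewrite unitmxE dA unitr1.
by rewrite -[RHS]mul1mx -(mulVmx uA) -mulmxA mul_adj2 dA mulmx1.
Qed.


Lemma sum3E (V : nmodType) (f : 'I_3 -> V) :
  \sum_i f i = f 0 + f 1 + f ord_max.
Proof.
rewrite !big_ord_recl big_ord0 addr0 addrA; congr (_ + f _ + f _);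
  exact/val_inj.
Qed.

Lemma det3E (T : comNzRingType) (V : 'M[T]_3) : \det V =
  V 0 0 * (V 1 1 * V ord_max ord_max - V 1 ord_max * V ord_max 1)
  - V 0 1 * (V 1 0 * V ord_max ord_max - V 1 ord_max * V ord_max 0)
  + V 0 ord_max * (V 1 0 * V ord_max 1 - V 1 1 * V ord_max 0).
Proof.
have e1 : lift 0 0 = 1 :> 'I_3 by exact/val_inj.
have e2 : lift 0 1 = ord_max :> 'I_3 by exact/val_inj.
have e3 : lift 1 0 = 0 :> 'I_3 by exact/val_inj.
have e4 : lift 1 1 = ord_max :> 'I_3 by exact/val_inj.
have e5 : lift ord_max 0 = 0 :> 'I_3 by exact/val_inj.
have e6 : lift ord_max 1 = 1 :> 'I_3 by exact/val_inj.
rewrite (expand_det_row _ 0) sum3E /cofactor !det2E !mxE.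
rewrite e1 e2 e3 e4 e5 e6 /=; ring.
Qed.

(** Coordinates along sigma_z, sigma_x, sigma_y, an even permutation of the usual order, so that
    products follow the cross product with factor [+ 'i]. *)
Definition pauli (v : 'rV[K]_3) : 'M[K]_2 :=
  \matrix_(i, j) if i == 0 then if j == 0 then v 0 0 else v 0 1 - 'i * v 0 ord_max
                 else if j == 0 then v 0 1 + 'i * v 0 ord_max else - v 0 0.

Definition tracefree A : 'rV[K]_3 :=
  \row_(k < 3) nth 0 [:: (A 0 0 - A 1 1) / 2; (A 0 1 + A 1 0) / 2;
                        'i * (A 0 1 - A 1 0) / 2] k.

Lemma pauli_tracefree A : pauli (tracefree A) = A - (\tr A / 2)%:M.
Proof.
apply: mx2P; rewrite ?mx2E /=; by field: (sqrCi K).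
Qed.

Lemma dot_tracefree M N : (tracefree M *m (tracefree N)^T) 0 0 =
  (\tr (M *m N) - \tr M * \tr N / 2) / 2.
Proof.
rewrite !mxE sum3E !mxE !mx2E /=; by field: (sqrCi K).
Qed.

(* Kills scalars in each argument: a multiple of the determinant of the
   traceless parts (tripleE). *)
Definition triple L B C := \tr (L *m (B *m C - C *m B)).

Definition frame L B C : 'M[K]_3 :=
  \matrix_(i < 3) tracefree (nth 0 [:: L; B; C] i).

(** Both sides are alternating and trilinear in the traceless parts; the constant is tr (sigma_z
    [sigma_x, sigma_y]) = 2i tr 1. *)
Lemma tripleE L B C : triple L B C = 4 * 'i * \det (frame L B C).
Proof.
rewrite det3E /triple /frame !mxE !mx2E /=; by field: (sqrCi K).
Qed.


(* Half the trace form on the traceless parts of (A B, B, C), where a, b, c, d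
   are the traces of A, B, C, A B C, and x, y those of A B, B C. *)
Definition gramx a b c d x y : 'M[K]_3 := \matrix_(i, j)
  nth 0 (nth [::]
  [:: [:: x ^+ 2 / 4 - 1;   (b * x / 2 - a) / 2; (d - x * c / 2) / 2];
      [:: (b * x / 2 - a) / 2; b ^+ 2 / 4 - 1;   (y - b * c / 2) / 2];
      [:: (d - x * c / 2) / 2; (y - b * c / 2) / 2; c ^+ 2 / 4 - 1]] i) j.

Lemma matrix3P (T : Type) m (A B : 'M[T]_(m, 3)) : (forall i, A i 0 = B i 0) ->
  (forall i, A i 1 = B i 1) -> (forall i, A i ord_max = B i ord_max) -> A = B.
Proof.
move=> e0 e1 e2; apply/matrixP => i j.
have I3 (k : 'I_3) : [\/ k = 0, k = 1 | k = ord_max].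
  by case: k => [[|[|[|//]]] hk]; [constructor 1|constructor 2|constructor 3];
    apply/val_inj.
by case: (I3 j) => ->.
Qed.

Lemma ord3P (P : 'I_3 -> Prop) : P 0 -> P 1 -> P ord_max -> forall i, P i.
Proof.
move=> p0 p1 p2 [[|[|[|//]]] hk].
- by rewrite (_ : Ordinal _ = 0)//; exact/val_inj.
- by rewrite (_ : Ordinal _ = 1)//; exact/val_inj.
- by rewrite (_ : Ordinal _ = ord_max)//; exact/val_inj.
Qed.

(** Only A B B is not yet a coordinate; Cayley-Hamilton gives tr (A B B) = b x - a. On the diagonal,
    tr (M^2) = (tr M)^2 - 2. *)
Lemma frame_gram A B C : \det A = 1 -> \det B = 1 -> \det C = 1 ->
  frame (A *m B) B C *m (frame (A *m B) B C)^T =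
  gramx (\tr A) (\tr B) (\tr C) (\tr (A *m B *m C)) (\tr (A *m B))
    (\tr (B *m C)).
Proof.
move=> dA dB dC.
set F := fun i : 'I_3 => nth 0 [:: A *m B; B; C] i.
have gE i j : (frame (A *m B) B C *m (frame (A *m B) B C)^T) i j =
    (\tr (F i *m F j) - \tr (F i) * \tr (F j) / 2) / 2.
  by rewrite -dot_tracefree !mxE; apply: eq_bigr => k _; rewrite !mxE.
have sq (M : 'M[K]_2) : \tr (M *m M) = \tr M ^+ 2 - 2 * \det M by mx2ring.
have dAB : \det (A *m B) = 1 by rewrite det_mulmx dA dB mulr1.
have tABB : \tr (A *m B *m B) = \tr B * \tr (A *m B) - \tr A.
  rewrite -[\tr A]mulr1 -dB; mx2ring.
apply: matrix3P; apply: ord3P; rewrite gE /F /= ?sq ?dAB ?dB ?dC ?tABB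
  ?[\tr (B *m (A *m B))]mxtrace_mulC ?[\tr (C *m (A *m B))]mxtrace_mulC
  ?[\tr (C *m B)]mxtrace_mulC ?tABB mxE /=; by field.
Qed.

Lemma pauliD v w : pauli (v + w) = pauli v + pauli w.
Proof. mx2eq. Qed.

Lemma pauliZ p v : pauli (p *: v) = p *: pauli v.
Proof. mx2eq. Qed.

Lemma tr_pauli v : \tr (pauli v) = 0.
Proof. mx2ring. Qed.

Lemma tracefree_pauli v : tracefree (pauli v) = v.
Proof.
apply: matrix3P => i; rewrite (ord1 i) !mxE /=; by field: (sqrCi K).
Qed.

Lemma tracefreeD M N : tracefree (M + N) = tracefree M + tracefree N.
Proof. apply: matrix3P => i; rewrite !mxE /=; by field. Qed.

Lemma tracefree_scalar p : tracefree p%:M = 0.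
Proof. apply: matrix3P => i; rewrite !mxE /=; by field. Qed.

Lemma det_traceless_part p v :
  \det ((p / 2)%:M + pauli v) = p ^+ 2 / 4 - (v *m v^T) 0 0.
Proof.
rewrite !mxE sum3E !mxE !mx2E /=; by field: (sqrCi K).
Qed.

Lemma triple_span L B C M : triple L B C != 0 ->
  exists p q r t, M = p%:M + q *: L + r *: B + t *: C.
Proof.
rewrite tripleE !mulf_eq0 !negb_or => /andP[_ dF].
have uF : frame L B C \in unitmx by rewrite unitmxE unitfE.
pose z := tracefree M *m invmx (frame L B C).
have zE : tracefree M = z 0 0 *: tracefree L + z 0 1 *: tracefree B +
    z 0 ord_max *: tracefree C.
  rewrite -[LHS](mulmxKV uF) -/z; apply/matrixP => i j.
  by rewrite (ord1 i) mxE sum3E !mxE.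
exists (\tr M / 2 - z 0 0 * \tr L / 2 - z 0 1 * \tr B / 2
  - z 0 ord_max * \tr C / 2), (z 0 0), (z 0 1), (z 0 ord_max).
transitivity ((\tr M / 2)%:M + pauli (tracefree M)).
  by rewrite pauli_tracefree addrC subrK.
rewrite zE !pauliD !pauliZ !pauli_tracefree.
mx2eq.
Qed.


Lemma triple_nonscalar A B C p : triple (A *m B) B C != 0 ->
  [/\ A <> p%:M, B <> p%:M, C <> p%:M & \det C = 1 -> A *m B *m C <> p%:M].
Proof.
move=> /negP tN0; split=> [eq|eq|eq|dC eq]; apply/tN0/eqP;
  rewrite /triple.
- by rewrite eq; mx2ring.
- by rewrite eq; mx2ring.
- by rewrite eq; mx2ring.
- have -> : A *m B = p *: adj2 C.
    by rewrite -mul_scalar_mx -eq -mulmxA mul_adj2 dC mulmx1.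
  by rewrite /adj2; mx2ring.
Qed.

Lemma triple_commutant L B C X : triple L B C != 0 ->
  X *m L = L *m X -> X *m B = B *m X -> X *m C = C *m X ->
  forall M, X *m M = M *m X.
Proof.
move=> tN0 XL XB XC M; have [p [q [r [t ->]]]] := triple_span M tN0.
by rewrite !mulmxDr !mulmxDl -!scalemxAr -!scalemxAl XL XB XC scalar_mxC.
Qed.

(** A common eigenvector would be one of every matrix, in particular of the elementary matrix E_ji
    with i distinct from j, which forces its i-th coordinate to vanish. *)
Lemma triple_no_eigenvector L B C (v : 'cV[K]_2) : triple L B C != 0 ->
  (exists a, L *m v = a *: v) -> (exists a, B *m v = a *: v) ->
  (exists a, C *m v = a *: v) -> v = 0.
Proof.
move=> tN0 [l Lv] [b Bv] [c Cv].
have Mv M : exists a, M *m v = a *: v.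
  have [p [q [r [t ->]]]] := triple_span M tN0.
  exists (p + q * l + r * b + t * c).
  by rewrite !mulmxDl -!scalemxAl Lv Bv Cv mul_scalar_mx !scalerA -!scalerDl.
have v0 (i j : 'I_2) : i != j -> v i 0 = 0.
  move=> ij; have [a /matrixP Ea] := Mv (delta_mx j i).
  have := Ea i 0; rewrite !mxE (eq_bigr (fun=> 0)); last first.
    by move=> k _; rewrite mxE (negbTE ij) mul0r.
  rewrite big1 // => /esym/eqP; rewrite mulf_eq0 => /orP[|/eqP//].
  move=> /eqP a0; have := Ea j 0; rewrite a0 !mxE mul0r (bigD1 i)//= !mxE !eqxx.
  by rewrite mul1r big1 ?addr0// => k /negbTE ki; rewrite mxE ki andbF mul0r.
apply/matrixP => i j; rewrite (ord1 j) mxE.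
by case: i => [[|[|//]] hi]; [apply: (v0 _ 1)|apply: (v0 _ 0)].
Qed.

Definition cross (v w : 'rV[K]_3) : 'rV[K]_3 := \row_(k < 3) nth 0
    [:: v 0 1 * w 0 ord_max - v 0 ord_max * w 0 1;
        v 0 ord_max * w 0 0 - v 0 0 * w 0 ord_max;
        v 0 0 * w 0 1 - v 0 1 * w 0 0] k.

Lemma crossC v w : cross v w = - cross w v.
Proof. by apply: matrix3P => i; rewrite !mxE /=; ring. Qed.

Lemma crossvv v : cross v v = 0.
Proof. apply: matrix3P => i; rewrite !mxE /=; ring. Qed.

Lemma pauliN v : pauli (- v) = - pauli v.
Proof. by rewrite -scaleN1r pauliZ scaleN1r. Qed.

Lemma pauli0 : pauli 0 = 0.
Proof. by rewrite -(scale0r 0) pauliZ scale0r. Qed.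

Lemma pauli_mul v w : pauli v *m pauli w =
  ((v *m w^T) 0 0)%:M + 'i *: pauli (cross v w).
Proof.
by apply: mx2P; rewrite [(_ *m _^T) _ _]mxE sum3E !mx2E /=; ring: (sqrCi K).
Qed.

Definition paulis A B C := [/\ [/\ A *m A = 1%:M, B *m B = 1%:M & C *m C = 1%:M],
  [/\ A *m B = 'i *: C, B *m C = 'i *: A & C *m A = 'i *: B] &
  [/\ B *m A = - ('i *: C), C *m B = - ('i *: A) & A *m C = - ('i *: B)]].

(** For O in SO_3 the adjugate is the transpose, so each entry equals its cofactor; row by row this
    is the cross product table. *)
Lemma pauli_paulis (O : 'M[K]_3) : O *m O^T = 1%:M -> \det O = 1 ->
  paulis (pauli (row 0 O)) (pauli (row 1 O)) (pauli (row ord_max O)).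
Proof.
move=> OO dO.
have adjO : \adj O = O^T.
  have h : \adj O *m O = 1%:M by rewrite mul_adj_mx dO.
  by rewrite -[RHS]mul1mx -h -mulmxA OO mulmx1.
have e1 : lift 0 0 = 1 :> 'I_3 by exact/val_inj.
have e2 : lift 0 1 = ord_max :> 'I_3 by exact/val_inj.
have e3 : lift 1 0 = 0 :> 'I_3 by exact/val_inj.
have e4 : lift 1 1 = ord_max :> 'I_3 by exact/val_inj.
have e5 : lift ord_max 0 = 0 :> 'I_3 by exact/val_inj.
have e6 : lift ord_max 1 = 1 :> 'I_3 by exact/val_inj.
have E i j : cofactor O i j = O i j.
  by have /matrixP/(_ j i) := adjO; rewrite !mxE.
have dot i j : (row i O *m (row j O)^T) 0 0 = (i == j)%:R.
  have /matrixP/(_ i j) := OO; rewrite !mxE => <-.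
  by apply: eq_bigr => k _; rewrite !mxE.
have [c01 c12 c20] : [/\ cross (row 0 O) (row 1 O) = row ord_max O,
    cross (row 1 O) (row ord_max O) = row 0 O &
    cross (row ord_max O) (row 0 O) = row 1 O].
  by split; apply: matrix3P => i; rewrite (ord1 i) !mxE /= -[RHS]E
    /cofactor det2E !mxE ?e1 ?e2 ?e3 ?e4 ?e5 ?e6 /=; ring.
by split; split; rewrite pauli_mul dot /= ?crossvv ?c01 ?c12 ?c20
  ?[cross (row 1 O) (row 0 O)]crossC ?[cross (row ord_max O) (row 1 O)]crossC
  ?[cross (row 0 O) (row ord_max O)]crossC ?c01 ?c12 ?c20
  ?pauliN ?pauli0 ?scaler0 ?addr0 // raddf0 add0r ?scalerN.
Qed.

Lemma paulis_cycle A B C : paulis A B C -> paulis B C A.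
Proof. by case=> -[? ? ?] [? ? ?] [? ? ?]. Qed.

(** Multiplying by A' on the left and by A on the right gives the same four terms, the first
    exchanged with the second and the third with the fourth. *)
Lemma paulis_intertwine A B C A' B' C' Y : paulis A B C -> paulis A' B' C' ->
  let P := Y + A' *m Y *m A + B' *m Y *m B + C' *m Y *m C in
  A' *m P = P *m A.
Proof.
case=> -[AA BB CC] [AB BC CA] [BA CB AC].
case=> -[AA' BB' CC'] [AB' BC' CA'] [BA' CB' AC'] /=.
rewrite !mulmxDr !mulmxDl !mulmxA AA' AB' AC' -!mulmxA AA BA CA.
rewrite !mulmx1 mul1mx !mulNmx !mulmxN -!scalemxAl -!scalemxAr.
by rewrite [RHS]addrAC; congr (_ + _ + _); rewrite addrC.
Qed.

(* Averaging over the Pauli bases e and f = e O: every matrix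
   P = Y + \sum_k f_k Y e_k satisfies P e_k = f_k P. *)
Lemma SO3_intertwine (O : 'M[K]_3) : O *m O^T = 1%:M -> \det O = 1 ->
  exists2 P, \det P = 1 & forall v, P *m pauli v = pauli (v *m O) *m P.
Proof.
move=> OO dO; have s' := pauli_paulis OO dO.
have s : paulis (pauli (row 0 1%:M)) (pauli (row 1 1%:M)) (pauli (row ord_max 1%:M)).
  by apply: pauli_paulis; rewrite ?det1// trmx1 mulmx1.
set e1 := pauli (row 0 1%:M) in s; set e2 := pauli (row 1 1%:M) in s.
set e3 := pauli (row _ 1%:M) in s.
set f1 := pauli (row 0 O) in s'; set f2 := pauli (row 1 O) in s'.
set f3 := pauli (row _ O) in s'.
pose P Y := Y + f1 *m Y *m e1 + f2 *m Y *m e2 + f3 *m Y *m e3.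
have P1 Y : f1 *m P Y = P Y *m e1 by exact: paulis_intertwine.
have P2 Y : f2 *m P Y = P Y *m e2.
  rewrite (_ : P Y = Y + f2 *m Y *m e2 + f3 *m Y *m e3 + f1 *m Y *m e1).
    by apply: paulis_intertwine; apply: paulis_cycle.
  by rewrite /P -!addrA; congr (_ + _); rewrite addrC -addrA.
have P3 Y : f3 *m P Y = P Y *m e3.
  rewrite (_ : P Y = Y + f3 *m Y *m e3 + f1 *m Y *m e1 + f2 *m Y *m e2).
    by apply: paulis_intertwine; do 2!apply: paulis_cycle.
  by rewrite /P -!addrA; congr (_ + _); rewrite addrA addrC.
have pauli_rowE (X : 'M[K]_3) v : pauli (v *m X) = v 0 0 *: pauli (row 0 X) +
    v 0 1 *: pauli (row 1 X) + v 0 ord_max *: pauli (row ord_max X).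
  rewrite -!pauliZ -!pauliD; congr pauli; apply/matrixP => i j.
  by rewrite (ord1 i) mxE sum3E !mxE.
have PE Y v : P Y *m pauli v = pauli (v *m O) *m P Y.
  move: (P Y) (P1 Y) (P2 Y) (P3 Y) => Q Q1 Q2 Q3.
  rewrite -[v in LHS]mulmx1 !pauli_rowE !mulmxDl !mulmxDr -!scalemxAl -!scalemxAr.
  by rewrite -/f1 -/f2 -/f3 Q1 Q2 Q3.
have [Y PY0] : exists Y, P Y <> 0.
  (* As the e_k are traceless, the (0, 0) entry of P for Y = E_00 and the
     (0, 1) entry of P for Y = E_01 add up to 2. *)
  have [P0|] := eqVneq (P (delta_mx 0 0)) 0; last by exists (delta_mx 0 0); exact/eqP.
  exists (delta_mx 0 1) => P1'; have /matrixP/(_ 0 0) := P0.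
  have /matrixP/(_ 0 1) := P1'; rewrite /P /e1 /e2 /e3 !mx2E /= => h1 h2.
  have /eqP : 0 + 0 = 2 :> K by rewrite -[X in X + _]h1 -[X in _ + X]h2; ring.
  by rewrite addr0 eq_sym pnatr_eq0.
(* If v P = 0, then v M P = 0 for all M, by the intertwining relation; taking M elementary gives P =
   0. *)
have dP : \det (P Y) != 0.
  apply/det0P => -[v v0 vP]; apply: PY0.
  have vM M : v *m M *m P Y = 0.
    suff /(_ (tracefree M)) : forall w, v *m pauli w *m P Y = 0.
      rewrite pauli_tracefree mulmxBr mulmxBl => /eqP; rewrite subr_eq0 => /eqP->.
      by rewrite mul_mx_scalar -scalemxAl vP scaler0.
    move=> w; have -> : w = w *m O^T *m O by rewrite -mulmxA mulmx1C ?mulmx1.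
    by rewrite -mulmxA -PE mulmxA vP mul0mx.
  have [j vj] : exists j, v 0 j != 0.
    by apply/rV0Pn; exact: v0.
  apply/matrixP => i k; have /matrixP/(_ 0 k) := vM (delta_mx j i).
  rewrite -[delta_mx j i](mul_delta_mx (0 : 'I_1)) mulmxA -mulmxA -rowE.
  rewrite -colE mxE big_ord1 !mxE => /eqP; rewrite mulf_eq0 (negbTE vj) /=.
  by move/eqP.
pose s0 := sqrtC (\det (P Y)).
have s0N0 : s0 != 0 by rewrite sqrtC_eq0.
exists (s0^-1 *: P Y) => [|v].
  by rewrite detZ exprVn sqrtCK mulVf.
by rewrite -scalemxAl PE scalemxAr.
Qed.

End PauliCoordinates.

(** * Rigidity of triples *)

Section Rigidity.
Context (K : numClosedFieldType).
Implicit Types (A B C L M N P Q X Y Z : 'M[K]_2).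

Lemma pauli_frame L B C i : let M := nth 0 [:: L; B; C] (i : 'I_3) in
  M = (\tr M / 2)%:M + pauli (row i (frame L B C)).
Proof. by move=> M; rewrite rowK pauli_tracefree addrC subrK. Qed.

Lemma tr_adj2 A : \tr (adj2 A) = \tr A.
Proof. rewrite /adj2; mx2ring. Qed.

Lemma tr_adj2_mul A B : \tr (adj2 A *m B) = \tr A * \tr B - \tr (A *m B).
Proof. by rewrite mulmxBl raddfB /= mul_scalar_mx mxtraceZ. Qed.

(** The relation tr X tr Y = tr (X Y) + tr (X Y^-1) for X = A B and Y = C B, where X Y^-1 = A
    C^-1. *)
Lemma tr_mul_tr A B C : \det B = 1 -> \tr (A *m B) * \tr (B *m C) =
  \tr (A *m B *m C *m B) + \tr A * \tr C - \tr (A *m C).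
Proof.
move=> dB; transitivity (\tr (A *m B *m C *m B)
  + \det B * (\tr A * \tr C - \tr (A *m C))); first by mx2ring.
by rewrite dB mul1r addrA.
Qed.

(** Inverting one of the two curves trades tr (X Y) for tr X tr Y - tr (X Y); by [tr_mul_tr] the
    difference then changes sign. *)
Lemma triple_resolution A B C : \det B = 1 ->
  [/\ \tr (A *m B *m (B *m C)) - \tr (A *m B *m C *m B) = triple (A *m B) B C,
    \tr (A *m B *m adj2 (B *m C)) - \tr (A *m adj2 C) = - triple (A *m B) B C,
    \tr (adj2 (A *m B) *m (B *m C)) - \tr (C *m adj2 A) = - triple (A *m B) B C &
    \tr (adj2 (A *m B) *m adj2 (B *m C)) - \tr (adj2 B *m adj2 (A *m B *m C))
      = triple (A *m B) B C].
Proof.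
have tE X Y : \tr (X *m adj2 Y) = \tr X * \tr Y - \tr (X *m Y).
  by rewrite mxtrace_mulC tr_adj2_mul mulrC mxtrace_mulC.
have ff : \tr (A *m B *m (B *m C)) - \tr (A *m B *m C *m B) = triple (A *m B) B C.
  by rewrite /triple mulmxBr raddfB /= -!mulmxA.
move=> dB; rewrite -ff; split=> //.
- by rewrite !tE tr_mul_tr//; ring.
- by rewrite tr_adj2_mul tE tr_mul_tr// [\tr (C *m A)]mxtrace_mulC; ring.
- by rewrite -!adj2M !tr_adj2 mxtrace_mulC.
Qed.

Lemma adj2_intertwine P B B' : \tr B = \tr B' -> P *m B = B' *m P ->
  P *m adj2 B = adj2 B' *m P.
Proof.
by move=> tB PB; rewrite mulmxBr mulmxBl PB tB scalar_mxC.
Qed.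

(** Frames with equal Gram matrices differ by an orthogonal matrix, and equal triple products put it
    in SO_3, where it lifts to a conjugation. *)
Lemma triple_rigid A B C A' B' C' :
    \det A = 1 -> \det B = 1 -> \det C = 1 ->
    \det A' = 1 -> \det B' = 1 -> \det C' = 1 ->
    \tr A = \tr A' -> \tr B = \tr B' -> \tr C = \tr C' ->
    \tr (A *m B *m C) = \tr (A' *m B' *m C') ->
    \tr (A *m B) = \tr (A' *m B') -> \tr (B *m C) = \tr (B' *m C') ->
    triple (A *m B) B C = triple (A' *m B') B' C' -> triple (A *m B) B C != 0 ->
  exists2 P, \det P = 1 &
    [/\ P *m A = A' *m P, P *m B = B' *m P & P *m C = C' *m P].
Proof.
move=> dA dB dC dA' dB' dC' tA tB tC tABC tAB tBC.
rewrite !tripleE => eqD; rewrite mulf_eq0 negb_or => /andP[k0 D0].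
move/(mulfI k0): eqD => eqD.
have := frame_gram dA dB dC; rewrite tA tB tC tABC tAB tBC.
rewrite -(frame_gram dA' dB' dC').
have := @pauli_frame (A *m B) B C; have := @pauli_frame (A' *m B') B' C'.
move: eqD D0; set V := frame _ B C; set V' := frame _ B' C'.
move=> eqD D0 V'E VE gramE.
have uV : V \in unitmx by rewrite unitmxE unitfE.
pose O := invmx V *m V'.
have OO : O *m O^T = 1%:M.
  by rewrite trmx_mul mulmxA -(mulmxA _ V') -gramE mulmxA mulVmx// mul1mx
    -trmx_mul mulVmx ?trmx1.
have dO : \det O = 1 by rewrite det_mulmx det_inv -eqD mulVf.
have [P dP PE] := SO3_intertwine OO dO.
have PF i : P *m nth 0 [:: A *m B; B; C] (i : 'I_3) =
    nth 0 [:: A' *m B'; B'; C'] i *m P.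
  rewrite VE V'E mulmxDr mulmxDl PE -row_mul mulKVmx// scalar_mxC.
  congr ((_ / 2)%:M *m _ + _); move: i.
  by apply: ord3P.
have PL := PF 0; have PB := PF 1; have PC := PF ord_max; rewrite /= in PL PB PC.
exists P => //; split=> //.
have {1}-> : A = (A *m B) *m adj2 B by rewrite -mulmxA mul_adj2 dB mulmx1.
have -> : A' = (A' *m B') *m adj2 B' by rewrite -mulmxA mul_adj2 dB' mulmx1.
by rewrite mulmxA PL -!mulmxA (adj2_intertwine tB PB).
Qed.

Lemma triple_sqr A B C A' B' C' :
    \det A = 1 -> \det B = 1 -> \det C = 1 ->
    \det A' = 1 -> \det B' = 1 -> \det C' = 1 ->
    \tr A = \tr A' -> \tr B = \tr B' -> \tr C = \tr C' ->
    \tr (A *m B *m C) = \tr (A' *m B' *m C') ->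
    \tr (A *m B) = \tr (A' *m B') -> \tr (B *m C) = \tr (B' *m C') ->
  triple (A *m B) B C ^+ 2 = triple (A' *m B') B' C' ^+ 2.
Proof.
move=> dA dB dC dA' dB' dC' tA tB tC tABC tAB tBC.
rewrite !tripleE !exprMn; congr (_ * _).
have sq (V : 'M[K]_3) : \det V ^+ 2 = \det (V *m V^T).
  by rewrite det_mulmx det_tr expr2.
by rewrite !sq !frame_gram// tA tB tC tABC tAB tBC.
Qed.

(* Both matrices have a cyclic vector, hence are conjugate to the companion
   matrix of their common characteristic polynomial. *)
Lemma nonscalar_conj M N : \det M = \det N -> \tr M = \tr N ->
  (forall p, M <> p%:M) -> (forall p, N <> p%:M) ->
  exists2 P, \det P = 1 & N = P *m M *m invmx P.
Proof.
move=> dMN tMN sM sN.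
pose comp : 'M[K]_2 := \matrix_(i, j) if j == 0 then (i == 1)%:R else
  if i == 0 then - \det M else \tr M.
have cyclic A : \det A = \det M -> \tr A = \tr M -> (forall p, A <> p%:M) ->
    exists2 Q, \det Q != 0 & A *m Q = Q *m comp.
  move=> dA tA sA.
  pose Q p q : 'M[K]_2 := \matrix_(i, j)
    let v k := if k == 0 then p else q in
    if j == 0 then v i else A i 0 * p + A i 1 * q.
  have QE p q : A *m Q p q = Q p q *m comp.
    by rewrite /comp -dA -tA; mx2eq.
  (* One of (1, 0), (0, 1), (1, 1) is cyclic: the first two fail together only for a diagonal
     matrix, and then the third fails only for a scalar one. *)
  have [r0|r0] := eqVneq (A 1 0) 0; last first.
    by exists (Q 1 0) => //; rewrite (_ : \det _ = A 1 0)//; mx2ring.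
  have [q0|q0] := eqVneq (A 0 1) 0; last first.
    exists (Q 0 1) => //; rewrite (_ : \det _ = - A 0 1) ?oppr_eq0//; mx2ring.
  exists (Q 1 1) => //.
  rewrite (_ : \det _ = A 1 1 - A 0 0); last by rewrite ?mx2E /= r0 q0; ring.
  rewrite subr_eq0; apply/eqP => e; apply: (sA (A 0 0)).
  by apply: mx2P; rewrite !mxE.
have [Q dQ QE] := cyclic M erefl erefl sM.
have [Q' dQ' QE'] := cyclic N (esym dMN) (esym tMN) sN.
have uQ : Q \in unitmx by rewrite unitmxE unitfE.
have uQ' : Q' \in unitmx by rewrite unitmxE unitfE.
pose P0 := Q' *m invmx Q.
have dP0 : \det P0 != 0 by rewrite det_mulmx det_inv mulf_neq0 ?invr_eq0.
have P0E : P0 *m M = N *m P0.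
  rewrite mulmxA QE' -!mulmxA; congr (_ *m _).
  by rewrite -[LHS](mulmxK uQ) -(mulmxA (invmx Q)) QE mulKmx.
have s0 : sqrtC (\det P0) != 0 by rewrite sqrtC_eq0.
have dP : \det ((sqrtC (\det P0))^-1 *: P0) = 1.
  by rewrite detZ exprVn sqrtCK mulVf.
exists ((sqrtC (\det P0))^-1 *: P0) => //.
by rewrite -scalemxAl P0E scalemxAr mulmxK// unitmxE dP unitr1.
Qed.

Lemma so3_commutator (S : 'M[K]_3) : S^T = - S ->
  exists2 Z, \tr Z = 0 & forall v, pauli (v *m S) = Z *m pauli v - pauli v *m Z.
Proof.
move=> ST.
have a i j : S j i = - S i j by have /matrixP/(_ i j) := ST; rewrite !mxE.
have d i : S i i = 0.
  apply/eqP; have /eqP := a i i; rewrite -subr_eq0 opprK -mulr2n mulrn_eq0.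
  by [].
(* For skew S, v S is the cross product s x v with the vector s displayed here; since
   [pauli z, pauli v] = 2i pauli (z x v), s is divided by 2i. *)
exists (pauli (- 'i / 2 *: \row_(k < 3) nth 0 [:: S 1 ord_max; - S 0 ord_max; S 0 1] k)).
  exact: tr_pauli.
move=> v; apply: mx2P; rewrite ?mx2E !sum3E ?d (a 0 1) (a 0 ord_max)
  (a 1 ord_max) /=; by field: (sqrCi K).
Qed.

End Rigidity.

(** * Tangent vectors *)

Section Adjoint.
Context (K : numClosedFieldType).
Implicit Types (A B C L M N P Q X Y Z : 'M[K]_2).

Definition adj_act A X := A *m X *m invmx A.

Lemma adj_actD A X Y : adj_act A (X + Y) = adj_act A X + adj_act A Y.
Proof. by rewrite /adj_act mulmxDr mulmxDl. Qed.

Lemma adj_actN A X : adj_act A (- X) = - adj_act A X.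
Proof. by rewrite /adj_act mulmxN mulNmx. Qed.

Lemma adj_actZ A (p : K) X : adj_act A (p *: X) = p *: adj_act A X.
Proof. by rewrite /adj_act -scalemxAr -scalemxAl. Qed.

Lemma unitmx_det1 A : \det A = 1 -> A \in unitmx.
Proof. by move=> dA; rewrite unitmxE dA unitr1. Qed.

Lemma adj_act_mul A X : \det A = 1 -> adj_act A X *m A = A *m X.
Proof. by move=> dA; rewrite mulmxKV ?unitmx_det1. Qed.

Lemma adj_act_mulA A X M : \det A = 1 ->
  adj_act A X *m (A *m M) = A *m (X *m M).
Proof. by move=> dA; rewrite mulmxA adj_act_mul// mulmxA. Qed.

Lemma adj_actM A B X : \det A = 1 -> \det B = 1 ->
  adj_act (A *m B) X = adj_act A (adj_act B X).
Proof.
move=> dA dB; have dAB : \det (A *m B) = 1 by rewrite det_mulmx dA dB mulr1.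
apply: (can_inj (mulmxK (unitmx_det1 dAB))).
by rewrite /= adj_act_mul// mulmxA adj_act_mul// -[RHS]mulmxA adj_act_mul// mulmxA.
Qed.

Lemma tr_adj_act A X : \det A = 1 -> \tr (adj_act A X) = \tr X.
Proof. by move=> dA; rewrite mxtrace_mulC mulmxA mulVmx ?mul1mx ?unitmx_det1. Qed.

Lemma tr_adj_act_mul A X Y : \det A = 1 ->
  \tr (adj_act A X *m adj_act A Y) = \tr (X *m Y).
Proof.
move=> dA; rewrite /adj_act -[in RHS](tr_adj_act (X *m Y) dA) /adj_act.
by rewrite !mulmxA mulmxKV ?unitmx_det1.
Qed.

Lemma adj_act_comm A X : \det A = 1 -> A *m X = X *m A -> adj_act A X = X.
Proof. by move=> dA AX; rewrite /adj_act AX mulmxK ?unitmx_det1. Qed.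

Lemma tr_coboundary_mul A X : \det A = 1 -> \tr ((adj_act A X - X) *m A) = 0.
Proof. by move=> dA; rewrite mulmxBl adj_act_mul// raddfB /= mxtrace_mulC subrr. Qed.

(** Ad-invariance of the trace form. This makes the pairing insensitive to the choice of the
    peripheral cochains. *)
Lemma tr_invariant_coboundary A Z X : \det A = 1 -> adj_act A Z = Z ->
  \tr (Z *m (adj_act A X - X)) = 0.
Proof. by move=> dA AZ; rewrite mulmxBr raddfB /= -{1}AZ tr_adj_act_mul// subrr. Qed.

Ltac mxlin := repeat match goal with |- context [adj_act ?a ?b] =>
    generalize (adj_act a b) end; intros;
  repeat match goal with x := _ |- _ => clearbody x end;
  apply/matrixP => ? ?; rewrite !mxE; ring.

(* The cocycle u moves the frame (A B, B, C) by a skew, hence inner,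
   infinitesimal transformation. *)
Lemma infinitesimal_rigid A B C u1 u2 u3 :
    \det A = 1 -> \det B = 1 -> \det C = 1 -> triple (A *m B) B C != 0 ->
    \tr u1 = 0 -> \tr u2 = 0 -> \tr u3 = 0 ->
    \tr (u1 *m A) = 0 -> \tr (u2 *m B) = 0 -> \tr (u3 *m C) = 0 ->
    \tr ((u1 + adj_act A u2) *m (A *m B)) = 0 ->
    \tr ((u2 + adj_act B u3) *m (B *m C)) = 0 ->
    \tr ((u1 + adj_act A u2 + adj_act (A *m B) u3) *m (A *m B *m C)) = 0 ->
  exists2 Z, \tr Z = 0 & [/\ u1 = adj_act A Z - Z, u2 = adj_act B Z - Z &
    u3 = adj_act C Z - Z].
Proof.
move=> dA dB dC tN0 tu1 tu2 tu3 tu1A tu2B tu3C.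
set L := A *m B in tN0 *.
have dL : \det L = 1 by rewrite det_mulmx dA dB mulr1.
set U := u1 + adj_act A u2 => tUL tBC tLC.
have tU : \tr U = 0 by rewrite raddfD /= tr_adj_act// tu1 tu2 addr0.
pose F (i : 'I_3) := nth 0 [:: L; B; C] i.
(* Velocities of the frame: a matrix M moved by the cocycle value u has derivative u M. The trace
   conditions make the Gram matrix stationary. *)
pose F' (i : 'I_3) := nth 0 [:: U *m L; u2 *m B; u3 *m C] i.
have tF' i : \tr (F' i) = 0 by move: i; apply: ord3P.
have sq (X N : 'M[K]_2) : \det N = 1 -> \tr X = 0 -> \tr (X *m N) = 0 ->
    \tr (X *m N *m N) = 0.
  move=> dN tX tXN.
  have -> : \tr (X *m N *m N) = \tr N * \tr (X *m N) - \det N * \tr X by mx2ring.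
  by rewrite tXN dN tX !mulr0 subrr.
(* Infinitesimal form of tr (A B B) = tr B tr (A B) - tr A, all three traces on the right being
   stationary. *)
have tLB : \tr (U *m L *m B) + \tr (L *m (u2 *m B)) = 0.
  have -> : U *m L *m B = \tr B *: (U *m L) - U *m A.
    have BB : B *m B = \tr B *: B - 1%:M by rewrite -dB; mx2eq.
    transitivity (U *m (A *m (B *m B))); first by rewrite /L !mulmxA.
    by rewrite BB !mulmxBr mulmx1 -!scalemxAr.
  have -> : L *m (u2 *m B) = A *m u2.
    rewrite -mulmxA; congr (_ *m _).
    have -> : B *m (u2 *m B) = \tr (u2 *m B) *: B - \det B *: adj2 u2.
      by rewrite /adj2; mx2eq.
    by rewrite tu2B dB scale0r sub0r scale1r /adj2 tu2 raddf0 sub0r opprK.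
  rewrite raddfB /= mxtraceZ tUL mulr0 sub0r mulmxDl raddfD /= tu1A add0r.
  by rewrite adj_act_mul// addNr.
have tLC' : \tr (U *m L *m C) + \tr (L *m (u3 *m C)) = 0.
  rewrite -[RHS]tLC mulmxDl adj_act_mulA// raddfD /=; congr (\tr _ + _).
  by rewrite mulmxA.
have tBC' : \tr (u2 *m B *m C) + \tr (B *m (u3 *m C)) = 0.
  rewrite -[RHS]tBC mulmxDl adj_act_mulA// raddfD /=; congr (\tr _ + _).
  by rewrite mulmxA.
have skewF i j : \tr (F' i *m F j) + \tr (F i *m F' j) = 0.
  move: i j; do 2!apply: ord3P; rewrite /F /F' /= ?[\tr (L *m (U *m L))]mxtrace_mulC
    ?[\tr (B *m (u2 *m B))]mxtrace_mulC ?[\tr (C *m (u3 *m C))]mxtrace_mulC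
    ?sq ?addr0 //.
  - by rewrite addrC mxtrace_mulC [X in _ + X]mxtrace_mulC.
  - by rewrite addrC mxtrace_mulC [X in _ + X]mxtrace_mulC.
  - by rewrite addrC mxtrace_mulC [X in _ + X]mxtrace_mulC.
pose V := frame L B C; pose V' := frame (U *m L) (u2 *m B) (u3 *m C).
have uV : V \in unitmx.
  by move: tN0; rewrite tripleE mulf_eq0 negb_or unitmxE unitfE => /andP[].
have skewV : V' *m V^T + V *m V'^T = 0.
  apply/matrixP => i j; rewrite mxE.
  have -> : (V' *m V^T) i j = (tracefree (F' i) *m (tracefree (F j))^T) 0 0.
    by rewrite !mxE; apply: eq_bigr => k _; rewrite !mxE.
  have -> : (V *m V'^T) i j = (tracefree (F i) *m (tracefree (F' j))^T) 0 0.
    by rewrite !mxE; apply: eq_bigr => k _; rewrite !mxE.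
  rewrite !dot_tracefree !tF' !mxE mul0r mulr0 mul0r !subr0 -mulrDl skewF.
  by rewrite mul0r.
pose S := invmx V *m V'.
have ST : S^T = - S.
  apply/eqP; rewrite -addr_eq0 addrC; apply/eqP.
  apply: (can_inj (mulKmx uV)); apply: (can_inj (mulmxK (_ : V^T \in unitmx))).
    by rewrite unitmx_tr.
  rewrite /= mulmxDr mulmx0 mul0mx mulmxDl mulKVmx// -mulmxA -trmx_mul.
  by rewrite mulKVmx.
have [Z tZ ZE] := so3_commutator ST.
have ZF i : F' i = Z *m F i - F i *m Z.
  have -> : F' i = (\tr (F' i) / 2)%:M + pauli (row i V') by exact: pauli_frame.
  rewrite tF' mul0r raddf0 add0r -(mulKVmx uV V') -/S row_mul ZE.
  have -> : F i = (\tr (F i) / 2)%:M + pauli (row i V) by exact: pauli_frame.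
  by rewrite mulmxDr mulmxDl scalar_mxC opprD addrACA subrr add0r.
have uE X N : \det N = 1 -> X *m N = Z *m N - N *m Z -> X = adj_act N (- Z) - - Z.
  move=> dN XN; rewrite adj_actN opprK addrC -[X](mulmxK (unitmx_det1 dN)) XN.
  by rewrite mulmxBl mulmxK ?unitmx_det1.
have u2E := uE _ _ dB (ZF 1); have u3E := uE _ _ dC (ZF ord_max).
exists (- Z); first by rewrite raddfN /= tZ oppr0.
split=> //; have /(canRL (addrK _)) -> := uE _ _ dL (ZF 0).
rewrite {1}u2E adj_actM//; move: (- Z) => W.
by rewrite adj_actD adj_actN opprB [LHS]addrC addrA subrK.
Qed.

(* The left-hand side is the pairing of the relative cocycle (u, x) with v.
   X and Y, the traceless parts of A B and B C, are the generators of the twist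
   flows along lambda and mu; u is p times the first one plus q times the second
   one plus the coboundary of Z. *)
Lemma symplectic_twists A B C (u1 u2 u3 v1 v2 v3 x1 x2 x3 x4 y1 y2 y3 y4 : 'M[K]_2) :
    \det A = 1 -> \det B = 1 -> \det C = 1 -> triple (A *m B) B C != 0 ->
    u1 = adj_act A x1 - x1 -> u2 = adj_act B x2 - x2 -> u3 = adj_act C x3 - x3 ->
    v1 = adj_act A y1 - y1 -> v2 = adj_act B y2 - y2 -> v3 = adj_act C y3 - y3 ->
  let u12 := u1 + adj_act A u2 in
  let v12 := v1 + adj_act A v2 in
  let u23 := u2 + adj_act B u3 in
  let v23 := v2 + adj_act B v3 in
  let u4 := u12 + adj_act (A *m B) u3 in
  let v4 := v12 + adj_act (A *m B) v3 in
    u4 = adj_act (A *m B *m C) x4 - x4 -> v4 = adj_act (A *m B *m C) y4 - y4 ->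
  - \tr (u1 *m adj_act A v2) - \tr (u12 *m adj_act (A *m B) v3)
    + \tr (x1 *m v1) + \tr (x2 *m v2) + \tr (x3 *m v3) - \tr (x4 *m v4) =
  (\tr (u12 *m (A *m B)) * \tr (v23 *m (B *m C))
   - \tr (v12 *m (A *m B)) * \tr (u23 *m (B *m C))) / triple (A *m B) B C.
Proof.
move=> dA dB dC tN0 u1E u2E u3E v1E v2E v3E.
move=> u12 v12 u23 v23 u4 v4 u4E v4E.
set D := triple _ _ _ in tN0 *.
have dAB : \det (A *m B) = 1 by rewrite det_mulmx dA dB mulr1.
have dBC : \det (B *m C) = 1 by rewrite det_mulmx dB dC mulr1.
have dABC : \det (A *m B *m C) = 1 by rewrite det_mulmx dAB dC mulr1.
have trcob M X : \det M = 1 -> \tr (adj_act M X - X) = 0.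
  by move=> dM; rewrite raddfB /= tr_adj_act// subrr.
have trcobN M X : \det M = 1 -> \tr (X - adj_act M X) = 0.
  by move=> dM; rewrite -opprB raddfN /= trcob ?oppr0.
have tr_cobN_mul M X : \det M = 1 -> \tr ((X - adj_act M X) *m M) = 0.
  by move=> dM; rewrite -opprB mulNmx raddfN /= tr_coboundary_mul ?oppr0.
pose X := A *m B - (\tr (A *m B) / 2)%:M.
pose Y := B *m C - (\tr (B *m C) / 2)%:M.
have ABX : adj_act (A *m B) X = X.
  by apply: adj_act_comm => //; rewrite mulmxBr mulmxBl scalar_mxC.
have BCY : adj_act (B *m C) Y = Y.
  by apply: adj_act_comm => //; rewrite mulmxBr mulmxBl scalar_mxC.
have ABCY : adj_act (A *m B *m C) Y = adj_act A Y.
  by rewrite -mulmxA adj_actM// BCY.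
have trX M : \tr M = 0 -> \tr (X *m M) = \tr (M *m (A *m B)).
  move=> tM; rewrite mulmxBl raddfB /= mul_scalar_mx mxtraceZ tM mulr0 subr0.
  by rewrite mxtrace_mulC.
have trY M : \tr M = 0 -> \tr (Y *m M) = \tr (M *m (B *m C)).
  move=> tM; rewrite mulmxBl raddfB /= mul_scalar_mx mxtraceZ tM mulr0 subr0.
  by rewrite mxtrace_mulC.
have tX : \tr X = 0 by rewrite /X ?mx2E /=; field.
have tY : \tr Y = 0 by rewrite /Y ?mx2E /=; field.
set dl := \tr (u12 *m (A *m B)); set dm := \tr (u23 *m (B *m C)).
(* Each twist fixes the trace of its own curve and moves that of the other at rate - D, so these
   multiples cancel both derivatives. *)
pose p := - dm / D; pose q := - dl / D.
have dYl : \tr ((adj_act A Y - Y) *m (A *m B)) = - D.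
  rewrite mulmxBl adj_act_mulA// raddfB /= /D /triple /Y; mx2ring.
have dXm : \tr (adj_act B (X - adj_act C X) *m (B *m C)) = - D.
  rewrite adj_act_mulA// mulmxBl adj_act_mul// /D /triple /X; mx2ring.
clearbody X Y.
(* The twist along mu conjugates A by elements commuting with B C, the twist along lambda conjugates
   C by elements commuting with A B. Either way A B C stays in its conjugacy class. *)
pose w1 := u1 - q *: (adj_act A Y - Y).
pose w3 := u3 - p *: (X - adj_act C X).
have [Z tZ [w1E w2E w3E]] : exists2 Z, \tr Z = 0 & [/\ w1 = adj_act A Z - Z,
    u2 = adj_act B Z - Z & w3 = adj_act C Z - Z].
  have w12E : w1 + adj_act A u2 = u12 - q *: (adj_act A Y - Y).
    by rewrite /w1 addrAC.
  have ABw3 : adj_act (A *m B) w3 =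
      adj_act (A *m B) u3 - p *: (X - adj_act (A *m B *m C) X).
    by rewrite /w3 adj_actD adj_actN adj_actZ adj_actD adj_actN ABX -adj_actM.
  apply: infinitesimal_rigid => //.
  - by rewrite /w1 raddfB /= mxtraceZ u1E !trcob// mulr0 subrr.
  - by rewrite u2E trcob.
  - by rewrite /w3 raddfB /= mxtraceZ u3E trcob// trcobN// mulr0 subrr.
  - by rewrite /w1 mulmxBl raddfB /= -scalemxAl mxtraceZ u1E !tr_coboundary_mul// mulr0 subrr.
  - by rewrite u2E tr_coboundary_mul.
  - rewrite /w3 mulmxBl raddfB /= -scalemxAl mxtraceZ u3E.
    by rewrite tr_coboundary_mul// tr_cobN_mul// mulr0 subrr.
  - rewrite w12E mulmxBl raddfB /= -scalemxAl mxtraceZ dYl -/dl.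
    by rewrite mulrN opprK mulfVK// addrN.
  - rewrite /w3 adj_actD adj_actN adj_actZ addrA -/u23 mulmxBl raddfB /=.
    rewrite -scalemxAl mxtraceZ dXm -/dm.
    by rewrite mulrN opprK mulfVK// addrN.
  - rewrite w12E ABw3 [_ *m _ *m C]lock addrACA -/u4 -lock u4E.
    rewrite -opprD mulmxBl raddfB /= tr_coboundary_mul// sub0r mulmxDl raddfD /=.
    rewrite -!scalemxAl !mxtraceZ -ABCY tr_coboundary_mul//.
    by rewrite tr_cobN_mul// !mulr0 addr0 oppr0.
have u1Z : u1 = adj_act A (Z + q *: Y) - (Z + q *: Y).
  rewrite -[LHS](subrK (q *: (adj_act A Y - Y))) -/w1 w1E adj_actD adj_actZ.
  mxlin.
have u3Z : u3 = adj_act C (Z - p *: X) - (Z - p *: X).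
  rewrite -[LHS](subrK (p *: (X - adj_act C X))) -/w3 w3E adj_actD adj_actN adj_actZ.
  mxlin.
(* Two cochains with the same coboundary differ by an invariant, which is orthogonal to
   coboundaries. *)
have inv M x z y : \det M = 1 -> adj_act M x - x = adj_act M z - z ->
    \tr (x *m (adj_act M y - y)) = \tr (z *m (adj_act M y - y)).
  move=> dM xz; apply/eqP; rewrite -subr_eq0 -raddfB /= -mulmxBl.
  rewrite tr_invariant_coboundary// adj_actD adj_actN; move/eqP: xz.
  rewrite -subr_eq0 => /eqP xz; apply/eqP; rewrite -subr_eq0 -[X in _ == X]xz.
  apply/eqP; mxlin.
have x1v : \tr (x1 *m v1) = \tr ((Z + q *: Y) *m v1).
  by rewrite v1E; apply: inv => //; rewrite -u1E.
have x2v : \tr (x2 *m v2) = \tr (Z *m v2).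
  by rewrite v2E; apply: inv => //; rewrite -u2E.
have x3v : \tr (x3 *m v3) = \tr ((Z - p *: X) *m v3).
  by rewrite v3E; apply: inv => //; rewrite -u3E.
have u12Z : u12 = adj_act (A *m B) Z - Z + q *: (adj_act A Y - Y).
  rewrite /u12 u1Z w2E !adj_actD adj_actN !adj_actZ adj_actM//.
  mxlin.
(* Both twists reach the fourth boundary component, since A B fixes X and B C fixes Y. *)
have x4v : \tr (x4 *m v4) = \tr ((Z - p *: X + q *: Y) *m v4).
  rewrite v4E; apply: inv => //; rewrite -u4E /u4 u12Z u3Z.
  rewrite !(adj_actD, adj_actN, adj_actZ) -!(@adj_actM (A *m B) C)// ABX ABCY.
  mxlin.
rewrite x1v x2v x3v x4v.
have e1 : \tr (u1 *m adj_act A v2) = \tr (Z *m v2) + q * \tr (Y *m v2)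
   - \tr (Z *m adj_act A v2) - q * \tr (Y *m adj_act A v2).
  rewrite u1Z adj_actD adj_actZ !(mulmxDl, mulNmx) -!scalemxAl.
  rewrite !(raddfD, raddfN, mxtraceZ) /= !mxtraceZ !tr_adj_act_mul//; ring.
have e2 : \tr (u12 *m adj_act (A *m B) v3) = \tr (Z *m v3)
   - \tr (Z *m adj_act (A *m B) v3) + q * \tr (Y *m adj_act B v3)
   - q * \tr (Y *m adj_act (A *m B) v3).
  rewrite u12Z !(mulmxDl, mulNmx) -!scalemxAl !(mulmxDl, mulNmx).
  rewrite !(raddfD, raddfN, mxtraceZ) /= !mxtraceZ !tr_adj_act_mul//.
  have -> : \tr (adj_act A Y *m adj_act (A *m B) v3) = \tr (Y *m adj_act B v3).
    by rewrite adj_actM// tr_adj_act_mul.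
  ring.
have e3 : \tr (X *m v12) = \tr (v12 *m (A *m B)).
  by rewrite trX// /v12 raddfD /= tr_adj_act// v1E v2E !trcob ?addr0.
have e4 : \tr (Y *m v23) = \tr (v23 *m (B *m C)).
  by rewrite trY// /v23 raddfD /= tr_adj_act// v2E v3E !trcob ?addr0.
have e5 : \tr (X *m adj_act (A *m B) v3) = \tr (X *m v3).
  by rewrite -{1}ABX tr_adj_act_mul.
rewrite e1 e2 -e3 -e4.
transitivity (p * \tr (X *m v12) - q * \tr (Y *m v23)); last first.
  by rewrite /p /q; move: (D) tN0 => D' D0; field.
rewrite /v4 /v23 /v12 !mulmxDl !mulmxDr !mulNmx -!scalemxAl.
rewrite !raddfD /= !raddfN /= !mxtraceZ e5; ring.
Qed.
End Adjoint.

(** * Holomorphic Cholesky factorization *)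

Section MatrixDifferentiability.
Context (K : numFieldType) (V : normedModType K).

Lemma differentiable_mx m n (f : V -> 'M[K]_(m, n)) v :
  (forall i j, differentiable (fun w => f w i j : K) v) -> differentiable f v.
Proof.
move=> df; rewrite (_ : f = \sum_(i < m) \sum_(j < n)
    (fun w => f w i j *: (delta_mx i j : 'M[K]_(m, n)))).
  by do 2!(apply: differentiable_sum => ?); apply: differentiableZl.
apply/funext => w; rewrite fct_sumE [LHS]matrix_sum_delta.
by apply: eq_bigr => i _; rewrite fct_sumE.
Qed.

Lemma differentiable_entry m n (f : V -> 'M[K]_(m, n)) v i j :
  differentiable f v -> differentiable (fun w => f w i j : K) v.
Proof.
move=> df; have := @differentiable_comp _ _ _ _ f (fun M => M i j : K) v df.
by apply; exact: differentiable_coord.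
Qed.

Lemma differentiable_sumr n (f : 'I_n -> V -> K) v :
  (forall i, differentiable (f i) v) -> differentiable (fun w => \sum_i f i w) v.
Proof.
move=> df; rewrite (_ : (fun w => _) = \sum_i f i); first exact: differentiable_sum.
by apply/funext => w; rewrite fct_sumE.
Qed.

Lemma differentiable_mulmx m n p (f : V -> 'M[K]_(m, n)) (g : V -> 'M[K]_(n, p)) v :
  differentiable f v -> differentiable g v ->
  differentiable (fun w => f w *m g w) v.
Proof.
move=> df dg; apply: differentiable_mx => i j.
rewrite (_ : (fun w => _) = fun w => \sum_k f w i k * g w k j); last first.
  by apply/funext => w; rewrite mxE.
apply: differentiable_sumr => k; apply: differentiableM; exact: differentiable_entry.
Qed.

Lemma differentiable_mxtrace n (f : V -> 'M[K]_n) v :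
  differentiable f v -> differentiable (fun w => \tr (f w) : K) v.
Proof.
by move=> df; apply: differentiable_sumr => i; exact: differentiable_entry.
Qed.

Lemma differentiable_scalar_mx n (f : V -> K) v :
  differentiable f v -> differentiable (fun w => (f w)%:M : 'M[K]_n) v.
Proof.
move=> df; apply: differentiable_mx => i j.
rewrite (_ : (fun w => _) = fun w => f w * (i == j)%:R); last first.
  by apply/funext => w; rewrite mxE mulr_natr.
by apply: differentiableM => //; exact: differentiable_cst.
Qed.

End MatrixDifferentiability.

Section SqrtNearOne.
Context (K : numClosedFieldType).
Implicit Types z s : K.

(* The branch of the square root that is holomorphic on the unit disc around 1:
   of the two roots, the one closer to 1. *)
Definition sqrt1 z : K :=
  let s := sqrtC z in if `|s - 1| <= `|s + 1| then s else - s.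

Lemma sqrt1K z : sqrt1 z ^+ 2 = z.
Proof. by rewrite /sqrt1; case: ifP => _; rewrite ?sqrrN sqrtCK. Qed.

(** For the root s closer to 1, |s - 1|^2 <= |s - 1| |s + 1| = |z - 1|. *)
Lemma sqrt1_near z : `|z - 1| < 1 -> `|sqrt1 z - 1| < 1.
Proof.
have le1 : `|sqrt1 z - 1| <= `|sqrt1 z + 1|.
  rewrite /sqrt1; case: ifP => // /negbT; rewrite -real_ltNge ?normr_real//.
  by move/ltW; rewrite -opprD normrN [- _ + 1]addrC [`|1 - _|]distrC.
move=> z1; rewrite -(@expr_lt1 _ 2)//; apply: le_lt_trans z1.
rewrite -{2}(sqrt1K z) -[1 in leRHS](expr1n _ 2) subr_sqr normrM expr2.
exact: ler_wpM2l.
Qed.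

End SqrtNearOne.

Section Cholesky.
Context (K : numFieldType) (sqrt1 : K -> K).
Context (sqrt1K : forall z, sqrt1 z ^+ 2 = z).
Context (sqrt1_near : forall z, `|z - 1| < 1 -> `|sqrt1 z - 1| < 1).
Implicit Types z : K.

Lemma sqrt1_1 : sqrt1 1 = 1.
Proof.
have : `|sqrt1 1 - 1| < 1 by apply: sqrt1_near; rewrite subrr normr0.
have /eqP := sqrt1K 1; rewrite sqrf_eq1 => /orP[/eqP ->//|/eqP ->].
by rewrite -opprD normrN -[1 + 1]/(2%:R) normr_nat ltrn1.
Qed.

Lemma sqrt1_neq0 z : `|z - 1| < 1 -> sqrt1 z != 0.
Proof.
move=> /sqrt1_near; apply: contraTneq => ->.
by rewrite sub0r normrN normr1 ltxx.
Qed.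

(** Keeps the denominator of the difference quotient of the root away from 0, uniformly in z'. *)
Lemma sqrt1_add_bound z z' : `|z' - 1| < 1 ->
  1 - `|sqrt1 z - 1| <= `|sqrt1 z' + sqrt1 z|.
Proof.
move=> /sqrt1_near/ltW h.
rewrite lerBlDr; apply: le_trans (_ : 2 - `|sqrt1 z' - 1| <= _).
  by rewrite lerBrDr -[2]/(1 + 1) lerD2l.
rewrite lerBlDr -[X in X <= _](@normr_nat K 2).
have -> : 2 = (sqrt1 z' + sqrt1 z) + (1 - sqrt1 z) + (1 - sqrt1 z') by ring.
by rewrite (le_trans (ler_normD _ _))// lerD ?[`|1 - _|]distrC//
  (le_trans (ler_normD _ _))// lerD ?[`|1 - _|]distrC.
Qed.

(** The difference quotient is the inverse of the sum of the two roots; the bound on that sum gives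
    continuity of the root, hence the limit. *)
Lemma differentiable_sqrt z : `|z - 1| < 1 -> differentiable (sqrt1 : K -> K) z.
Proof.
move=> z1; have d0 : 0 < 1 - `|sqrt1 z - 1| by rewrite subr_gt0 sqrt1_near.
have near1 : \forall h \near (0 : K), `|h + z - 1| < 1.
  near=> h.
  have : `|h| < 1 - `|z - 1|.
    near: h; apply: (@nbhs0_lt K K); by rewrite subr_gt0.
  rewrite ltrBrDr => /(le_lt_trans _); apply.
  by rewrite -addrA ler_normD.
have quot h : `|h + z - 1| < 1 -> sqrt1 (h + z) - sqrt1 z = h / (sqrt1 (h + z) + sqrt1 z).
  move=> h1; have := sqrt1_add_bound z h1; move/(lt_le_trans d0).
  rewrite normr_gt0 => s0; apply: (canRL (mulfK s0)).
  by rewrite -subr_sqr !sqrt1K addrK.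
have cvgs : sqrt1 (h + z) @[h --> (0 : K)] --> sqrt1 z.
  apply/(@cvgrPdist_lt K K _ (nbhs (0 : K)) _) => e e0; near=> h.
  have h1 : `|h + z - 1| < 1 by near: h.
  rewrite distrC quot// normrM normfV ltr_pdivrMr; last first.
    exact: lt_le_trans d0 (sqrt1_add_bound z h1).
  have he : `|h| < e * (1 - `|sqrt1 z - 1|).
    near: h; apply: (@nbhs0_lt K K); exact: mulr_gt0.
  by apply: lt_le_trans he _; rewrite ler_wpM2l ?sqrt1_add_bound// ltW.
apply/derivable1_diffP; apply/cvg_ex; exists (sqrt1 z + sqrt1 z)^-1.
have s0 : sqrt1 z + sqrt1 z != 0.
  rewrite -normr_gt0; apply: lt_le_trans d0 _; exact: sqrt1_add_bound.
have : (sqrt1 (h + z) + sqrt1 z)^-1 @[h --> 0^'] --> (sqrt1 z + sqrt1 z)^-1.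
  apply: cvg_within_filter.
  by apply: cvgV => //; apply: cvgD => //; exact: cvg_cst.
apply: cvg_trans; apply: near_eq_cvg; rewrite near_withinE; near=> h => h0.
have h1 : `|h + z - 1| < 1 by near: h.
rewrite /= -[h *: 1]/(h * 1) mulr1 quot//.
by rewrite -[_ *: _]/(_ * _) mulKf.
Unshelve. all: by end_near.
Qed.


Implicit Types H : 'M[K]_3.

(** Entries of the lower triangular T with H = T T^T: transpose without conjugation, so that T is
    holomorphic in H. *)
Definition chol00 H := sqrt1 (H 0 0).
Definition chol10 H := H 1 0 * (chol00 H)^-1.
Definition chol20 H := H ord_max 0 * (chol00 H)^-1.
Definition pivot1 H := H 1 1 - chol10 H * chol10 H.
Definition chol11 H := sqrt1 (pivot1 H).
Definition chol21 H := (H ord_max 1 - chol20 H * chol10 H) * (chol11 H)^-1.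
Definition pivot2 H :=
  H ord_max ord_max - chol20 H * chol20 H - chol21 H * chol21 H.
Definition chol22 H := sqrt1 (pivot2 H).

Definition cholesky H : 'M[K]_3 := \matrix_(i, j)
  nth 0 (nth [::] [:: [:: chol00 H; 0; 0]; [:: chol10 H; chol11 H; 0];
                      [:: chol20 H; chol21 H; chol22 H]] i) j.

(* The last condition keeps the triple product of the section off the opposite
   square root of the Gram determinant. *)
Definition cholesky_dom : set 'M[K]_3 := [set H : 'M[K]_3 |
  [/\ `|H 0 0 - 1| < 1, `|pivot1 H - 1| < 1, `|pivot2 H - 1| < 1 &
      `|chol00 H * chol11 H * chol22 H - 1| < 1]].

Lemma cholesky_mul H : H^T = H -> cholesky_dom H ->
  cholesky H *m (cholesky H)^T = H.
Proof.
move=> HT [d0 d1 d2 _].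
have sym i j : H i j = H j i by rewrite -[in LHS]HT mxE.
have n0 := sqrt1_neq0 d0; have n1 := sqrt1_neq0 d1.
have e00 : chol00 H * chol00 H = H 0 0 by rewrite -expr2 sqrt1K.
have e11 : chol11 H * chol11 H = pivot1 H by rewrite -expr2 sqrt1K.
have e22 : chol22 H * chol22 H = pivot2 H by rewrite -expr2 sqrt1K.
have e10 : chol10 H * chol00 H = H 1 0 by rewrite mulfVK.
have e20 : chol20 H * chol00 H = H ord_max 0 by rewrite mulfVK.
have e21 : chol21 H * chol11 H = H ord_max 1 - chol20 H * chol10 H.
  by rewrite mulfVK.
apply: matrix3P; apply: ord3P; rewrite mxE sum3E !mxE /= ?mulr0 ?mul0r ?addr0.
- exact: e00.
- exact: e10.
- exact: e20.
- by rewrite mulrC e10 sym.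
- by rewrite e11 addrC subrK.
- by rewrite e21 addrC subrK.
- by rewrite mulrC e20 sym.
- by rewrite [_ * chol21 H]mulrC e21 [chol10 H * _]mulrC addrC subrK sym.
- by rewrite e22 /pivot2; ring.
Qed.

Lemma det_cholesky H : \det (cholesky H) = chol00 H * chol11 H * chol22 H.
Proof. rewrite det3E !mxE /=; ring. Qed.

Lemma cholesky_dom1 : cholesky_dom 1%:M.
Proof.
have e00 : chol00 1%:M = 1 by rewrite /chol00 mxE sqrt1_1.
have e10 : chol10 1%:M = 0 by rewrite /chol10 mxE mul0r.
have e20 : chol20 1%:M = 0 by rewrite /chol20 mxE mul0r.
have p1 : pivot1 1%:M = 1 by rewrite /pivot1 e10 mxE mulr0 subr0.
have e11 : chol11 1%:M = 1 by rewrite /chol11 p1 sqrt1_1.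
have e21 : chol21 1%:M = 0 by rewrite /chol21 e20 !mxE mul0r subrr mul0r.
have p2 : pivot2 1%:M = 1 by rewrite /pivot2 e20 e21 mxE mulr0 !subr0.
have e22 : chol22 1%:M = 1 by rewrite /chol22 p2 sqrt1_1.
by split; rewrite ?p1 ?p2 ?e00 ?e11 ?e22 ?mulr1 ?mxE subrr normr0.
Qed.

Lemma differentiable_chol00 H : `|H 0 0 - 1| < 1 ->
  differentiable (chol00 : 'M[K]_3 -> K) H.
Proof.
move=> d0; apply: (@differentiable_comp _ _ _ _ (fun M : 'M[K]_3 => M 0 0 : K)).
  exact: differentiable_coord.
exact: differentiable_sqrt.
Qed.

Lemma differentiable_chol_col0 H i : `|H 0 0 - 1| < 1 ->
  differentiable (fun M : 'M[K]_3 => M i 0 * (chol00 M)^-1 : K) H.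
Proof.
move=> d0; apply: differentiableM; first exact: differentiable_coord.
by apply: differentiableV; [exact: differentiable_chol00|exact: sqrt1_neq0].
Qed.

Lemma differentiable_pivot1 H : `|H 0 0 - 1| < 1 ->
  differentiable (pivot1 : 'M[K]_3 -> K) H.
Proof.
move=> d0; apply: differentiableB; first exact: differentiable_coord.
by apply: differentiableM; exact: differentiable_chol_col0.
Qed.

Lemma differentiable_chol11 H : `|H 0 0 - 1| < 1 -> `|pivot1 H - 1| < 1 ->
  differentiable (chol11 : 'M[K]_3 -> K) H.
Proof.
move=> d0 d1; apply: (@differentiable_comp _ _ _ _ (pivot1 : _ -> K)).
  exact: differentiable_pivot1.
exact: differentiable_sqrt.
Qed.

Lemma differentiable_chol21 H : `|H 0 0 - 1| < 1 -> `|pivot1 H - 1| < 1 ->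
  differentiable (chol21 : 'M[K]_3 -> K) H.
Proof.
move=> d0 d1; apply: differentiableM.
  apply: differentiableB; first exact: differentiable_coord.
  by apply: differentiableM; exact: differentiable_chol_col0.
by apply: differentiableV; [exact: differentiable_chol11|exact: sqrt1_neq0].
Qed.

Lemma differentiable_pivot2 H : `|H 0 0 - 1| < 1 -> `|pivot1 H - 1| < 1 ->
  differentiable (pivot2 : 'M[K]_3 -> K) H.
Proof.
move=> d0 d1; apply: differentiableB; last first.
  by apply: differentiableM; exact: differentiable_chol21.
apply: differentiableB; first exact: differentiable_coord.
by apply: differentiableM; exact: differentiable_chol_col0.
Qed.

Lemma differentiable_chol22 H : cholesky_dom H ->
  differentiable (chol22 : 'M[K]_3 -> K) H.
Proof.
case=> d0 d1 d2 _; apply: (@differentiable_comp _ _ _ _ (pivot2 : _ -> K)).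
  exact: differentiable_pivot2.
exact: differentiable_sqrt.
Qed.

Lemma differentiable_cholesky H : cholesky_dom H -> differentiable cholesky H.
Proof.
move=> dH; have [d0 d1 d2 _] := dH.
have E i j : (fun w => cholesky w i j : K) = (fun w =>
    nth 0 (nth [::] [:: [:: chol00 w; 0; 0]; [:: chol10 w; chol11 w; 0];
                      [:: chol20 w; chol21 w; chol22 w]] i) j).
  by apply/funext => w; rewrite mxE.
apply: differentiable_mx => i j; rewrite {}E; move: i j.
do 2!apply: ord3P; rewrite /=; try exact: differentiable_cst.
- exact: differentiable_chol00.
- exact: differentiable_chol_col0.
- exact: differentiable_chol11.
- exact: differentiable_chol_col0.
- exact: differentiable_chol21.
- exact: differentiable_chol22.
Qed.

Lemma near_one_ball (V : normedModType K) (q : V -> K) v :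
  differentiable q v -> `|q v - 1| < 1 -> \forall w \near v, `|q w - 1| < 1.
Proof.
move=> /differentiable_continuous cq qv.
have e0 : 0 < 1 - `|q v - 1| by rewrite subr_gt0.
have near_q := @cvgr_dist_lt K K _ (nbhs v) (nbhs_filter v) q (q v) cq _ e0.
apply: filterS near_q => w; rewrite ltrBrDr distrC; apply: le_lt_trans.
have -> : q w - 1 = (q w - q v) + (q v - 1) by rewrite addrA subrK.
exact: ler_normD.
Qed.

(** Each condition makes the quantity in the next one differentiable, so the four are open in
    turn. *)
Lemma open_cholesky_dom : open cholesky_dom.
Proof.
rewrite openE => H dH; have [d0 d1 d2 d3] := dH; rewrite /interior.
have n0 := near_one_ball (differentiable_coord H 0 0) d0.
have n1 := near_one_ball (differentiable_pivot1 d0) d1.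
have n2 := near_one_ball (differentiable_pivot2 d0 d1) d2.
have dd : differentiable (fun M => chol00 M * chol11 M * chol22 M : K) H.
  apply: differentiableM; last exact: differentiable_chol22.
  by apply: differentiableM; [exact: differentiable_chol00|exact: differentiable_chol11].
have n3 := near_one_ball dd d3.
by apply: filterS (filterI (filterI n0 n1) (filterI n2 n3)) => M [[? ?] [? ?]].
Qed.

End Cholesky.

(** * Local sections of the trace coordinates *)

Section FrameRealization.
Context (K : numClosedFieldType).

Definition of_frame (x b c : K) (V : 'M[K]_3) (i : 'I_3) : 'M[K]_2 :=
  (nth 0 [:: x; b; c] i / 2)%:M + pauli (row i V).

Lemma tr_of_frame x b c V i : \tr (of_frame x b c V i) = nth 0 [:: x; b; c] i.
Proof.
by rewrite raddfD /= tr_pauli addr0 ?mx2E /=; field.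
Qed.

Lemma tracefree_of_frame x b c V i : tracefree (of_frame x b c V i) = row i V.
Proof. by rewrite tracefreeD tracefree_scalar add0r tracefree_pauli. Qed.

(** Converse of [frame_gram]: the diagonal of the Gram matrix encodes the determinants, the rest the
    mixed traces, and L B^-1 is the first generator. *)
Lemma of_frame_gram a b c d x y V : V *m V^T = gramx a b c d x y ->
  let L := of_frame x b c V 0 in let B := of_frame x b c V 1 in
  let C := of_frame x b c V ord_max in
  [/\ [/\ \det L = 1, \det B = 1 & \det C = 1],
    [/\ \tr (L *m adj2 B) = a, \tr B = b, \tr C = c & \tr (L *m C) = d],
    \tr L = x, \tr (B *m C) = y & triple L B C = 4 * 'i * \det V].
Proof.
move=> VV L B C.
have dot i j : (row i V *m (row j V)^T) 0 0 = gramx a b c d x y i j.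
  by rewrite -VV !mxE; apply: eq_bigr => k _; rewrite !mxE.
have dt i : \det (of_frame x b c V i) =
    (nth 0 [:: x; b; c] i) ^+ 2 / 4 - gramx a b c d x y i i.
  by rewrite det_traceless_part dot.
have tr i j : \tr (of_frame x b c V i *m of_frame x b c V j) =
    nth 0 [:: x; b; c] i * nth 0 [:: x; b; c] j / 2 + 2 * gramx a b c d x y i j.
  have := dot_tracefree (of_frame x b c V i) (of_frame x b c V j).
  by rewrite !tracefree_of_frame dot !tr_of_frame => ->; field.
have trLB : \tr (L *m adj2 B) = x * b - \tr (L *m B).
  by rewrite mulmxBr raddfB /= mul_mx_scalar mxtraceZ !tr_of_frame /= mulrC.
split; first by rewrite !dt !mxE /=; split; field.
- rewrite trLB !tr !tr_of_frame !mxE /=; by split=> //; field.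
- by rewrite tr_of_frame.
- by rewrite tr !mxE /=; field.
- rewrite tripleE; congr (_ * \det _); apply/row_matrixP; apply: ord3P;
    by rewrite rowK tracefree_of_frame.
Qed.

Lemma trmx_gramx (a b c d x y : K) : (gramx a b c d x y)^T = gramx a b c d x y.
Proof. by apply: matrix3P; apply: ord3P; rewrite !mxE. Qed.

End FrameRealization.

Section LocalSection.
Context (R : realType).
Local Notation C := (Cx R).
Local Notation M2 := 'M[C]_2.

Lemma differentiable_pauli (V : normedModType C) (f : V -> 'rV[C]_3) v :
  differentiable f v -> differentiable (fun w => pauli (f w) : M2) v.
Proof.
move=> df; apply: differentiable_mx => i j.
have fk k : differentiable (fun w => f w 0 k : C) v by exact: differentiable_entry.
have fi : differentiable (fun w => 'i * f w 0 ord_max : C) v.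
  by apply: differentiableM; [exact: differentiable_cst|exact: fk].
rewrite (_ : (fun w => _) = fun w => if i == 0 then if j == 0 then f w 0 0
    else f w 0 1 - 'i * f w 0 ord_max
    else if j == 0 then f w 0 1 + 'i * f w 0 ord_max else - f w 0 0); last first.
  by apply/funext => w; rewrite mxE.
case: (i == 0); case: (j == 0).
- exact: fk.
- exact: (differentiableB (fk 1) fi).
- exact: (differentiableD (fk 1) fi).
- exact: (differentiableN (fk 0)).
Qed.

Lemma differentiable_of_frame (V : normedModType C) (x : V -> C) (b c : C)
    (f : V -> 'M[C]_3) v i : differentiable x v -> differentiable f v ->
  differentiable (fun w => of_frame (x w) b c (f w) i : M2) v.
Proof.
move=> dx df; apply: differentiableD.
  apply: differentiable_scalar_mx; apply: differentiableM; last first.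
    exact: differentiable_cst.
  by move: i; apply: ord3P; [exact: dx|exact: differentiable_cst|exact: differentiable_cst].
apply: differentiable_pauli; apply: differentiable_mx => k j.
rewrite (_ : (fun w => _) = fun w => f w i j); last first.
  by apply/funext => w; rewrite mxE.
exact: differentiable_entry.
Qed.

Lemma differentiable_gramx (a b c d : C) (w : 'rV[C]_2) :
  differentiable (fun w : 'rV[C]_2 => gramx a b c d (w 0 0) (w 0 1) : 'M[C]_3) w.
Proof.
have dx : differentiable (fun w : 'rV[C]_2 => w 0 0 : C) w by exact: differentiable_coord.
have dy : differentiable (fun w : 'rV[C]_2 => w 0 1 : C) w by exact: differentiable_coord.
have dc (k : C) : differentiable (fun w : 'rV[C]_2 => k) w by exact: differentiable_cst.
apply: differentiable_mx => i j.
rewrite (_ : (fun w => _) = fun w : 'rV[C]_2 =>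
  nth 0 (nth [::]
  [:: [:: (w 0 0) ^+ 2 / 4 - 1;   (b * w 0 0 / 2 - a) / 2; (d - w 0 0 * c / 2) / 2];
      [:: (b * w 0 0 / 2 - a) / 2; b ^+ 2 / 4 - 1;   (w 0 1 - b * c / 2) / 2];
      [:: (d - w 0 0 * c / 2) / 2; (w 0 1 - b * c / 2) / 2; c ^+ 2 / 4 - 1]] i) j);
  last by apply/funext => w'; rewrite mxE.
have d01 : differentiable (fun w : 'rV[C]_2 => (b * w 0 0 / 2 - a) / 2 : C) w.
  by do ?[apply: differentiableM|apply: differentiableB].
have d02 : differentiable (fun w : 'rV[C]_2 => (d - w 0 0 * c / 2) / 2 : C) w.
  by do ?[apply: differentiableM|apply: differentiableB].
have d12 : differentiable (fun w : 'rV[C]_2 => (w 0 1 - b * c / 2) / 2 : C) w.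
  by do ?[apply: differentiableM|apply: differentiableB].
have d00 : differentiable (fun w : 'rV[C]_2 => (w 0 0) ^+ 2 / 4 - 1 : C) w.
  by do ?[apply: differentiableM|apply: differentiableB].
by move: i j; do 2!apply: ord3P.
Qed.

Definition trace_pair (A1 A2 A3 : M2) : 'rV[C]_2 :=
  \row_j (if j == 0 then \tr (A1 *m A2) else \tr (A2 *m A3)).

Lemma local_section (A1 A2 A3 : M2) (t := triple (A1 *m A2) A2 A3) :
    \det A1 = 1 -> \det A2 = 1 -> \det A3 = 1 -> t != 0 ->
  exists (W : set 'rV[C]_2) (f1 f2 f3 : 'rV[C]_2 -> M2),
  [/\ open W, W (trace_pair A1 A2 A3) & forall w, W w ->
    [/\ [/\ \det (f1 w) = 1, \det (f2 w) = 1 & \det (f3 w) = 1],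
      [/\ \tr (f1 w) = \tr A1, \tr (f2 w) = \tr A2, \tr (f3 w) = \tr A3 &
        \tr (f1 w *m f2 w *m f3 w) = \tr (A1 *m A2 *m A3)],
      trace_pair (f1 w) (f2 w) (f3 w) = w,
      `|triple (f1 w *m f2 w) (f2 w) (f3 w) - t| < `|t| &
      [/\ differentiable f1 w, differentiable f2 w & differentiable f3 w]]].
Proof.
move=> d1 d2 d3 tN0.
pose b := \tr A2; pose c := \tr A3.
pose V0 := frame (A1 *m A2) A2 A3.
have tE : t = 4 * 'i * \det V0 by exact: tripleE.
have uV : V0 \in unitmx.
  by move: tN0; rewrite tE mulf_eq0 negb_or unitmxE unitfE => /andP[].
pose G (w : 'rV[C]_2) := gramx (\tr A1) b c (\tr (A1 *m A2 *m A3)) (w 0 0) (w 0 1).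
(* The Gram matrix relative to the base frame, equal to the identity at the base point because the
   Gram matrix there is V0 V0^T. *)
pose H w := invmx V0 *m G w *m (invmx V0)^T.
pose V w := V0 *m cholesky (@sqrt1 C) (H w).
pose W := H @^-1` cholesky_dom (@sqrt1 C).
have dH w : differentiable H w.
  apply: differentiable_mulmx; last exact: differentiable_cst.
  apply: differentiable_mulmx; first exact: differentiable_cst.
  exact: differentiable_gramx.
pose fL (w : 'rV[C]_2) := of_frame (w 0 0) b c (V w) 0.
pose f2 (w : 'rV[C]_2) := of_frame (w 0 0) b c (V w) 1.
pose f3 (w : 'rV[C]_2) := of_frame (w 0 0) b c (V w) ord_max.
pose f1 (w : 'rV[C]_2) := fL w *m adj2 (f2 w).
exists W, f1, f2, f3; split.
- apply: open_comp; last exact: open_cholesky_dom (@sqrt1K C) (@sqrt1_near C).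
  by move=> w _; exact/differentiable_continuous/dH.
- rewrite /W /= /H /G (_ : gramx _ _ _ _ _ _ = V0 *m V0^T).
    rewrite mulKmx// -trmx_mul mulVmx// trmx1.
    exact: cholesky_dom1 (@sqrt1K C) (@sqrt1_near C).
  by rewrite frame_gram// /trace_pair !mxE.
move=> w Ww.
have HT : (H w)^T = H w.
  by rewrite /H !trmx_mul trmxK trmx_gramx mulmxA.
have VV : V w *m (V w)^T = G w.
  rewrite /V trmx_mul mulmxA -(mulmxA V0) cholesky_mul//;
    [|exact: sqrt1K|exact: sqrt1_near].
  by rewrite /H !mulmxA mulmxV// mul1mx -mulmxA -trmx_mul mulmxV// trmx1 mulmx1.
have [[dL dB dC] [tA tB tC tD] tL tM tT] := of_frame_gram VV.
rewrite -/(fL w) -/(f2 w) -/(f3 w) in dL dB dC tA tB tC tD tL tM tT.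
have f12 : f1 w *m f2 w = fL w.
  by rewrite /f1 -mulmxA adj2_mul dB mulmx1.
have dV : differentiable V w.
  apply: differentiable_mulmx; first exact: differentiable_cst.
  apply: (@differentiable_comp _ _ _ _ H); first exact: dH.
  by apply: (differentiable_cholesky (@sqrt1K C) (@sqrt1_near C)).
have dx : differentiable (fun w : 'rV[C]_2 => w 0 0 : C) w by exact: differentiable_coord.
have df2 : differentiable f2 w by exact: (differentiable_of_frame _ _ _ dx dV).
split.
- by split=> //; rewrite det_mulmx det_adj2 dL dB mulr1.
- by rewrite f12.
- apply/rowP => j; rewrite mxE f12 tL tM.
  case: eqP => [->//|]; case: j => [[|[|//]] hj] j0; last first.
    by congr (w _ _); exact/val_inj.
  by case: j0; exact/val_inj.
(* The triple product of the section is t times the determinant of the Cholesky factor, which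
   [cholesky_dom] keeps within 1 of 1. *)
- rewrite f12 tT tE /V det_mulmx det_cholesky mulrA -{2}[_ * \det V0]mulr1 -mulrBr.
  rewrite normrM -[ltRHS]mulr1 ltr_pM2l; first by case: Ww.
  by rewrite normr_gt0 -tE.
- have dL' : differentiable fL w by exact: (differentiable_of_frame _ _ _ dx dV).
  split; [|exact: df2|exact: (differentiable_of_frame _ _ _ dx dV)].
  apply: (differentiable_mulmx dL'); apply: (differentiableB _ df2).
  exact: (differentiable_scalar_mx _ (differentiable_mxtrace df2)).
Qed.

End LocalSection.

(** * Representations of the free group *)

Section Representations.
Context (R : realType).
Local Notation C := (Cx R).
Local Notation M2 := 'M[C]_2.
Implicit Types (rho : rep R) (g h : pi1) (u v : pi1 -> M2) (F : 'I_3 -> M2).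

Lemma rep1 rho : is_rep rho -> rho 1%g = 1%:M.
Proof.
move=> [dr mr]; apply: (can_inj (mulmxK (unitmx_det1 (dr 1%g)))).
by rewrite /= -mr mulg1 mul1mx.
Qed.

Lemma repV rho g : is_rep rho -> rho g^-1%g = adj2 (rho g).
Proof.
move=> rr; have [dr mr] := rr.
rewrite -invmx_adj2//; apply: (can_inj (mulmxK (unitmx_det1 (dr g)))).
by rewrite /= -mr mulVg rep1// mulVmx ?unitmx_det1.
Qed.

Definition letter_mx F (a : 'I_3 * bool) : M2 :=
  if a.2 then adj2 (F a.1) else F a.1.

Definition word_mx F (w : seq ('I_3 * bool)) : M2 :=
  foldr (fun a M => letter_mx F a *m M) 1%:M w.

Definition word_rep F : rep R := fun g => word_mx F (val g).

Lemma word_mx_push F a w : (forall i, \det (F i) = 1) ->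
  word_mx F (push a w) = letter_mx F a *m word_mx F w.
Proof.
move=> dF; case: w => [//|b w] /=; case: eqP => [->|//].
rewrite mulmxA (_ : _ *m letter_mx F (linv a) = 1%:M) ?mul1mx//.
by rewrite /letter_mx /linv /=; case: a.2; rewrite /= ?adj2_mul ?mul_adj2 dF.
Qed.

Lemma word_rep_is_rep F : (forall i, \det (F i) = 1) -> is_rep (word_rep F).
Proof.
move=> dF; split=> [g|g h]; rewrite /word_rep.
  elim: (val g) => [|a w IH] /=; first by rewrite det1.
  by rewrite det_mulmx IH mulr1 /letter_mx; case: a.2; rewrite ?det_adj2 dF.
rewrite /= ; elim: (val g) => [|a w IH] /=; first by rewrite mul1mx.
by rewrite word_mx_push// IH mulmxA.
Qed.

Lemma word_rep_gen F i : word_rep F (fg_gen i) = F i.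
Proof. by rewrite /word_rep /= mulmx1. Qed.

Lemma rep_word rho g : is_rep rho ->
  rho g = word_rep (fun i => rho (fg_gen i)) g.
Proof.
move=> rr; have [dr mr] := rr; case: g => w rw; rewrite /word_rep /=.
elim: w rw => [|a w IH] rw /=.
  by rewrite -(rep1 rr); congr rho; exact/val_inj.
have rw' : reduced w by exact: path_sorted rw.
rewrite -(IH rw').
have -> : letter_mx (fun i => rho (fg_gen i)) a = rho (Sub [:: a] isT : pi1).
  rewrite /letter_mx; case: a {rw} => i [] /=; rewrite -?repV//; congr rho;
    exact/val_inj.
rewrite -mr; congr rho; apply/val_inj => /=.
by case: w rw {IH rw'} => //= b w /andP[/negbTE ->].
Qed.

Lemma rep_ext rho rho' : is_rep rho -> is_rep rho' ->
  rho gamma1 = rho' gamma1 -> rho gamma2 = rho' gamma2 ->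
  rho gamma3 = rho' gamma3 -> rho = rho'.
Proof.
move=> rr rr' e1 e2 e3; apply/funext => g; rewrite (rep_word g rr) (rep_word g rr').
have -> : (fun i => rho (fg_gen i)) = (fun i => rho' (fg_gen i)); last by [].
apply/funext; apply: ord3P.
- by rewrite (_ : 0 = inord 0)//; apply/val_inj; rewrite /= inordK.
- by rewrite (_ : 1 = inord 1)//; apply/val_inj; rewrite /= inordK.
- by rewrite (_ : ord_max = inord 2)//; apply/val_inj; rewrite /= inordK.
Qed.

Definition rep3 (A1 A2 A3 : M2) : rep R :=
  word_rep (fun i => nth 0 [:: A1; A2; A3] i).

Lemma rep3E A1 A2 A3 : [/\ rep3 A1 A2 A3 gamma1 = A1,
  rep3 A1 A2 A3 gamma2 = A2 & rep3 A1 A2 A3 gamma3 = A3].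
Proof. by rewrite /rep3 !word_rep_gen !inordK. Qed.

Lemma rep3_is_rep A1 A2 A3 : \det A1 = 1 -> \det A2 = 1 -> \det A3 = 1 ->
  is_rep (rep3 A1 A2 A3).
Proof. by move=> d1 d2 d3; apply: word_rep_is_rep; apply: ord3P. Qed.

End Representations.


(** * Traces, their differentials and the pairing on representations *)

Section RepresentationTraces.
Context (R : realType).
Local Notation C := (Cx R).
Local Notation M2 := 'M[C]_2.
Implicit Types (rho : rep R) (g h : pi1) (u v : pi1 -> M2).

Definition rep_triple rho : C :=
  triple (rho (gamma1 * gamma2)%g) (rho gamma2) (rho gamma3).

Lemma rep_tripleE rho : is_rep rho -> rep_triple rho =
  triple (rho gamma1 *m rho gamma2) (rho gamma2) (rho gamma3).
Proof. by case=> _ mr; rewrite /rep_triple mr. Qed.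

Lemma tr_resolution rho (ol om : bool) : is_rep rho ->
  \tr (rho (lam ol * mu om)%g) - \tr (rho (alpha ol om * beta ol om)%g) =
  (-1) ^+ (ol (+) om) * rep_triple rho.
Proof.
move=> rr; have [dr mr] := rr; rewrite rep_tripleE//.
have [ff ft tf tt] := triple_resolution (rho gamma1) (rho gamma3) (dr gamma2).
rewrite /lam /mu /alpha /beta; case: ol; case: om => /=;
  rewrite ?expr0 ?expr1 ?mulN1r ?mul1r !(mr, repV _ rr).
- exact: tt.
- exact: tf.
- exact: ft.
- exact: ff.
Qed.

(** The triple product written with traces of group elements: visibly invariant under conjugation,
    and continuous on all functions from the group. *)
Definition trace_gap rho : C :=
  \tr (rho (gamma1 * gamma2 * (gamma2 * gamma3))%g) -
  \tr (rho (gamma1 * gamma2 * gamma3 * gamma2)%g).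

Lemma trace_gapE rho : is_rep rho -> trace_gap rho = rep_triple rho.
Proof. by move/(tr_resolution false false); rewrite expr0 mul1r. Qed.

Lemma tr_lam rho ol : is_rep rho ->
  \tr (rho (lam ol)) = \tr (rho gamma1 *m rho gamma2).
Proof.
move=> rr; have [dr mr] := rr.
by rewrite /lam; case: ol; rewrite ?repV// ?tr_adj2 !mr.
Qed.

Lemma tr_mu rho om : is_rep rho ->
  \tr (rho (mu om)) = \tr (rho gamma2 *m rho gamma3).
Proof.
move=> rr; have [dr mr] := rr.
by rewrite /mu; case: om; rewrite ?repV// ?tr_adj2 !mr.
Qed.

(** Infinitesimal form of tr (g^-1) = tr g, from u (g^-1) = - Ad_{g^-1} (u g) and tr (u g) = 0. *)
Lemma Z1_inv rho u g : is_rep rho -> Z1 rho u ->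
  \tr (u g^-1%g *m rho g^-1%g) = \tr (u g *m rho g).
Proof.
move=> rr [tu mu]; have [dr mr] := rr.
have u1 : u 1%g = 0.
  have := mu 1%g 1%g; rewrite /Ad (rep1 rr) invmx1 mulmx1 mul1mx mulg1.
  by move=> /eqP; rewrite -subr_eq0 opprD addrA subrr sub0r oppr_eq0 => /eqP.
have : u (g^-1 * g)%g = 0 by rewrite mulVg.
rewrite mu => /eqP; rewrite addr_eq0 => /eqP ->.
rewrite mulNmx (adj_act_mul (u g) (dr g^-1%g)) repV// /adj2 mulmxBl.
by rewrite raddfN raddfB /= mul_scalar_mx mxtraceZ tu mulr0 sub0r opprK mxtrace_mulC.
Qed.

Lemma dtr_lam rho u ol : is_rep rho -> Z1 rho u ->
  dtr (lam ol) rho u = \tr (u (gamma1 * gamma2)%g *m rho (gamma1 * gamma2)%g).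
Proof. by move=> rr zu; rewrite dtrE /lam; case: ol; [exact: Z1_inv|]. Qed.

Lemma dtr_mu rho u om : is_rep rho -> Z1 rho u ->
  dtr (mu om) rho u = \tr (u (gamma2 * gamma3)%g *m rho (gamma2 * gamma3)%g).
Proof. by move=> rr zu; rewrite dtrE /mu; case: om; [exact: Z1_inv|]. Qed.

Lemma bdry_group_bdry i : bdry_group i (bdry i).
Proof. by exists 1%N; left; rewrite expg1. Qed.

Lemma sum_fund_sign (V : zmodType) (f : 'I_4 -> V) :
  \sum_i f i *~ fund_sign i = f 0 + f 1 + f 2%:R - f ord_max.
Proof.
rewrite !big_ord_recl big_ord0 addr0 /fund_sign /= !mulr1z mulrN1z !addrA.
by congr (f _ + f _ + f _ - f _); exact/val_inj.
Qed.

Lemma pairingE rho a v : pairing rho a v =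
  - \tr (a.1 gamma1 *m Ad rho gamma1 (v gamma2))
  - \tr (a.1 (gamma1 * gamma2)%g *m Ad rho (gamma1 * gamma2)%g (v gamma3))
  + \tr (a.2 0 *m v gamma1) + \tr (a.2 1 *m v gamma2)
  + \tr (a.2 2%:R *m v gamma3)
  - \tr (a.2 ord_max *m v (gamma1 * gamma2 * gamma3)%g).
Proof.
have signs (V : zmodType) (p q r s t w : V) :
    - p + - q - (- r + - s + - t - - w) = - p - q + r + s + t - w.
  by rewrite !opprD !opprK !addrA.
rewrite /pairing sum_fund_sign /fund2 big_cons big_seq1; exact: signs.
Qed.

Lemma pairing_lift rho u v a : is_rep rho -> rep_triple rho != 0 ->
  tangent rho u -> tangent rho v -> lifts rho u a ->
  pairing rho a v =
  (dtr (lam false) rho u * dtr (mu false) rho v -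
   dtr (lam false) rho v * dtr (mu false) rho u) / rep_triple rho.
Proof.
move=> rr tN0 [zu _] [zv tv] [[za ta] [X tX uX]]; have [dr mr] := rr.
(* The lift carries only a cohomologous cocycle; coboundaries are velocities of conjugations and do
   not move traces. *)
have dtrX g : \tr (a.1 g *m rho g) = \tr (u g *m rho g).
  by rewrite uX mulmxDl raddfD /= tr_coboundary_mul ?addr0.
rewrite !dtr_lam// !dtr_mu// -!dtrX.
have av i : a.1 (bdry i) = cobound rho (a.2 i) (bdry i).
  by apply: (ta i).2; exact: bdry_group_bdry.
have [y yv] : exists y, forall i, v (bdry i) = cobound rho (y i) (bdry i).
  have /choice[y yv] i : exists Y, v (bdry i) = cobound rho Y (bdry i).
    by have [Y _ vY] := tv i; exists Y; apply: vY; exact: bdry_group_bdry.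
  by exists y.
have [_ au] := za; have [_ vu] := zv.
have := symplectic_twists (dr gamma1) (dr gamma2) (dr gamma3) _
  (av 0) (av 1) (av 2%:R) (yv 0) (yv 1) (yv 2%:R).
move: (av ord_max) (yv ord_max).
rewrite /cobound /Ad /bdry /= !au !vu !mr /Ad !mr => a4 y4.
move/(_ _ _ _ a4 y4); rewrite rep_tripleE// in tN0 *.
move=> <-//; rewrite pairingE !au !vu /Ad !mr.
by [].
Qed.

End RepresentationTraces.

(** * Conjugacy classes of representations and their trace invariants *)

Section FreeRepresentations.
Context (R : realType).
Local Notation C := (Cx R).
Local Notation M2 := 'M[C]_2.
Implicit Types (rho : rep R) (g h : pi1) (F : 'I_3 -> M2).

Lemma conj_is_rep rho P : \det P = 1 -> is_rep rho ->
  is_rep (fun g => P *m rho g *m invmx P : M2).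
Proof.
move=> dP [dr mr]; split=> [g|g h].
  by rewrite !det_mulmx det_inv dP dr invr1 !mulr1.
by rewrite mr !mulmxA mulmxKV ?unitmx_det1.
Qed.

Lemma conj_class_tr rho rho' g : conj_class rho rho' -> \tr (rho' g) = \tr (rho g).
Proof. by case=> P dP ->; rewrite (tr_adj_act _ dP). Qed.

Lemma conj_class_rep rho rho' : is_rep rho -> conj_class rho rho' -> is_rep rho'.
Proof.
move=> rr [P dP E]; have -> : rho' = (fun g => P *m rho g *m invmx P : M2).
  by apply/funext.
exact: conj_is_rep.
Qed.

Lemma conj_class_eq rho rho' : conj_class rho rho' ->
  conj_class rho = conj_class rho'.
Proof.
case=> P dP E; have uP := unitmx_det1 dP; apply/seteqP; split=> s [Q dQ sE].
  have dQP : \det (Q *m invmx P) = 1 by rewrite det_mulmx det_inv dP invr1 mulr1.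
  exists (Q *m invmx P) => [|g]; first exact: dQP.
  rewrite sE E.
  by have := adj_actM (rho g) dQP dP; rewrite /adj_act mulmxKV.
exists (Q *m P); first by rewrite det_mulmx dP dQ mulr1.
move=> g; rewrite sE E.
by have := adj_actM (rho g) dQ dP; rewrite /adj_act => ->; rewrite !mulmxA.
Qed.

Lemma rep_triple_conj rho rho' : is_rep rho -> conj_class rho rho' ->
  rep_triple rho' = rep_triple rho.
Proof.
move=> rr cc; have rr' := conj_class_rep rr cc.
rewrite -(trace_gapE rr) -(trace_gapE rr') /trace_gap.
by congr (_ - _); exact: conj_class_tr.
Qed.

(** Together with 1, the images of gamma1 gamma2, gamma2 and gamma3 span all matrices, which
    excludes invariant lines and noncentral centralizers. *)
Lemma good_of_triple rho : is_rep rho -> rep_triple rho != 0 -> good rho.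
Proof.
move=> rr tN0; have [dr mr] := rr; rewrite rep_tripleE// in tN0.
split=> //.
  move=> [P [v v0 ->]] Pr; have [_ [a aE]] := Pr (gamma1 * gamma2)%g.
  rewrite mr in aE.
  move/eqP: v0; apply; apply: (triple_no_eigenvector tN0); first by exists a.
    by have [] := Pr gamma2.
  by have [] := Pr gamma3.
apply/seteqP; split=> X [dX XC]; split=> //.
  move=> B _; apply: (triple_commutant tN0) => //.
  by rewrite -mr XC.
by move=> g; apply: XC.
Qed.

Lemma triple_bdry_nonscalar rho i p : is_rep rho -> rep_triple rho != 0 ->
  rho (bdry i) <> p%:M.
Proof.
move=> rr tN0; have [dr mr] := rr; rewrite rep_tripleE// in tN0.
have [h1 h2 h3 h4] := triple_nonscalar p tN0.
case: i => [[|[|[|[|//]]]] hi] //; rewrite /bdry /= ?mr//.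
by apply: h4; exact: dr.
Qed.

Lemma regular_nonscalar (A : M2) p : \det A = 1 -> regular_elt A -> A <> p%:M.
Proof.
move=> dA [A1 AN1] Ap; move/eqP: dA; rewrite Ap det_scalar sqrf_eq1.
by case/orP => /eqP pE; [apply: A1|apply: AN1]; rewrite Ap pE// raddfN.
Qed.

Lemma rep_rigid rho rho' : is_rep rho -> is_rep rho' -> rep_triple rho != 0 ->
  (forall i, \tr (rho (bdry i)) = \tr (rho' (bdry i))) ->
  \tr (rho (gamma1 * gamma2)%g) = \tr (rho' (gamma1 * gamma2)%g) ->
  \tr (rho (gamma2 * gamma3)%g) = \tr (rho' (gamma2 * gamma3)%g) ->
  rep_triple rho = rep_triple rho' -> conj_class rho rho'.
Proof.
move=> rr rr' tN0 tb tl tm tt; have [dr mr] := rr; have [dr' mr'] := rr'.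
have := tb ord_max; rewrite /bdry /= !mr !mr' => t4.
rewrite !mr !mr' in tl tm; rewrite !rep_tripleE// in tN0 tt.
have [P dP [P1 P2 P3]] := triple_rigid (dr gamma1) (dr gamma2) (dr gamma3)
  (dr' gamma1) (dr' gamma2) (dr' gamma3) (tb 0) (tb 1) (tb 2%:R) t4 tl tm tt tN0.
exists P => [//|g]; have uP := unitmx_det1 dP.
suff E : rho' = (fun g => P *m rho g *m invmx P : M2) by rewrite E.
apply: (rep_ext rr' (conj_is_rep dP rr)).
all: by rewrite ?P1 ?P2 ?P3 mulmxK.
Qed.

Lemma rep_triple_sqr rho rho' : is_rep rho -> is_rep rho' ->
  (forall i, \tr (rho (bdry i)) = \tr (rho' (bdry i))) ->
  \tr (rho (gamma1 * gamma2)%g) = \tr (rho' (gamma1 * gamma2)%g) ->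
  \tr (rho (gamma2 * gamma3)%g) = \tr (rho' (gamma2 * gamma3)%g) ->
  rep_triple rho ^+ 2 = rep_triple rho' ^+ 2.
Proof.
move=> rr rr' tb tl tm; have [dr mr] := rr; have [dr' mr'] := rr'.
have := tb ord_max; rewrite /bdry /= !mr !mr' => t4.
rewrite !mr !mr' in tl tm; rewrite (rep_tripleE rr) (rep_tripleE rr').
exact: (triple_sqr (dr gamma1) (dr gamma2) (dr gamma3)
  (dr' gamma1) (dr' gamma2) (dr' gamma3) (tb 0) (tb 1) (tb 2%:R) t4 tl tm).
Qed.

End FreeRepresentations.

Lemma near_eq_differentiable (K : numFieldType) (V W : normedModType K)
    (f g : V -> W) (x : V) :
  {near x, f =1 g} -> differentiable f x -> differentiable g x.
Proof.
move=> fg df; have gx : g x = f x by rewrite (nbhs_singleton fg).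
have E : g \o shift x = cst (g x) + 'd f x +o_ 0 id.
  apply/eqaddoP => e e0; have /eqaddoP/(_ e e0) near_o := diff_locally df.
  move: fg; rewrite -[X in X -> _]/(\forall y \near x, f y = g y).
  rewrite (near_shift 0 x) subr0 => fg.
  by apply: filterS2 fg near_o => h /= fgh; rewrite gx !fctE /= fgh.
have cd := diff_continuous df.
apply/diff_locallyP.
by rewrite (diff_unique cd E).
Qed.

Lemma ord4P (P : 'I_4 -> Prop) : P 0 -> P 1 -> P 2%:R -> P ord_max ->
  forall i, P i.
Proof.
move=> p0 p1 p2 p3 [[|[|[|[|//]]]] hi].
- by rewrite (_ : Ordinal hi = 0)//; exact/val_inj.
- by rewrite (_ : Ordinal hi = 1)//; exact/val_inj.
- by rewrite (_ : Ordinal hi = 2%:R)//; exact/val_inj.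
- by rewrite (_ : Ordinal hi = ord_max)//; exact/val_inj.
Qed.

(** * The trace coordinates are a local parameterization *)

Section Main.
Context (R : realType).
Local Notation C := (Cx R).
Local Notation M2 := 'M[C]_2.
Implicit Types (rho : rep R) (g h : pi1).

Lemma continuous_rep_trace g : continuous (fun rho : rep R => \tr (rho g) : C).
Proof.
move=> rho.
have ctr : {for rho g, continuous (fun A : M2 => \tr A : C)}.
  apply: differentiable_continuous; apply: differentiable_mxtrace.
  exact: (@ex_diff _ _ _ _ _ id id).
exact: (continuous_comp (@proj_continuous pi1 (fun=> M2) g rho) ctr).
Qed.

Lemma rowE2 (v : 'rV[C]_2) : v = v 0 0 *: delta_mx 0 0 + v 0 1 *: delta_mx 0 1.
Proof.
rewrite [LHS]matrix_sum_delta big_ord1 !big_ord_recl big_ord0 addr0.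
by congr (_ + _ *: delta_mx _ _); [congr (v _ _)|]; exact/val_inj.
Qed.

Definition rep_pair rho : 'rV[C]_2 :=
  trace_pair (rho gamma1) (rho gamma2) (rho gamma3).

Lemma trpairE (ol om : bool) rho : is_rep rho ->
  trpair (lam ol) (mu om) (conj_class rho) = rep_pair rho.
Proof.
move=> rr; apply/rowP => j; rewrite !mxE !trfunE.
by case: ifP => _; rewrite ?tr_lam ?tr_mu.
Qed.

Lemma holo_on_trpair rho0 X g h : holo_on_Rstar rho0 X (trpair g h : _ -> 'rV[C]_2).
Proof.
move=> n V f oV hf fX v Vv; have [W [p [oW Wv pP]]] := hf v Vv.
have VWv : \forall w \near v, V w /\ W w.
  by apply: filterI; [exact: open_nbhs_nbhs|exact: open_nbhs_nbhs].
pose F w : 'rV[C]_2 := \row_j (if j == 0 then \tr (p w g) else \tr (p w h)).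
apply: (@near_eq_differentiable _ _ _ F).
  apply: filterS VWv => w [Vw Ww]; have [_ pf _] := pP w Vw Ww.
  by apply/rowP => j; rewrite /= -pf !mxE !trfunE.
have [_ _ dp] := pP v Vv Wv.
apply: differentiable_mx => i j.
rewrite (_ : (fun w => _) = fun w => if j == 0 then \tr (p w g) else \tr (p w h)).
  by case: (j == 0); apply: differentiable_mxtrace; exact: dp.
by apply/funext => w; rewrite mxE.
Qed.

Lemma Homstar_tr rho0 rho i : Homstar rho0 rho ->
  \tr (rho (bdry i)) = \tr (rho0 (bdry i)).
Proof.
by case=> _ /(_ i)[P dP ->]; rewrite (tr_adj_act _ dP).
Qed.

Lemma differentiable_word (V : normedModType C) (F : V -> 'I_3 -> M2) v g :
  (forall i, differentiable (fun w => F w i) v) ->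
  differentiable (fun w => word_rep (F w) g : M2) v.
Proof.
move=> dF; rewrite /word_rep; elim: (val g) => [|a w IH] /=.
  exact: differentiable_cst.
apply: (differentiable_mulmx _ IH); rewrite /letter_mx; case: a.2; last exact: dF.
apply: (differentiableB _ (dF a.1)).
exact: (differentiable_scalar_mx _ (differentiable_mxtrace (dF a.1))).
Qed.

(** Uses traces of single group elements, in order to be continuous on all functions; it agrees with
    [rep_pair] on representations. *)
Definition trace_coords rho : 'rV[C]_2 :=
  \tr (rho (gamma1 * gamma2)%g) *: delta_mx 0 0 +
  \tr (rho (gamma2 * gamma3)%g) *: delta_mx 0 1.

Lemma continuous_trace_coords : continuous trace_coords.
Proof.
move=> rho; have F : Filter (nbhs rho) := nbhs_filter rho.
by apply: cvgD; apply: cvgZ; [exact: continuous_rep_trace|exact: cvg_cst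
  |exact: continuous_rep_trace|exact: cvg_cst].
Qed.

Lemma trace_coordsE rho : is_rep rho -> trace_coords rho = rep_pair rho.
Proof.
move=> [_ mr]; rewrite /trace_coords !mr [RHS]rowE2 /rep_pair /trace_pair.
by congr (_ *: _ + _ *: _); rewrite mxE.
Qed.

Lemma continuous_trace_gap : continuous (@trace_gap R).
Proof.
move=> rho; have F : Filter (nbhs rho) := nbhs_filter rho.
by apply: cvgB; exact: continuous_rep_trace.
Qed.

(** The two differences add up to - 2 y. *)
Lemma near_opp (K : numDomainType) (x y : K) : `|x - y| < `|y| ->
  `|- x - y| < `|y| -> False.
Proof.
move=> h1 h2; have := ltrD h1 h2.
have : `|y + y| <= `|x - y| + `|- x - y|.
  rewrite -[`|y + y|]normrN (_ : - (y + y) = (x - y) + (- x - y)).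
    exact: ler_normD.
  by rewrite addrACA subrr add0r opprD.
by move=> /le_lt_trans h /h; rewrite -mulr2n normrMn -mulr2n ltxx.
Qed.

(** The neighborhood is the image of the section in the quotient, so that the section is the inverse
    map; the point is that this image is open. *)
Lemma local_biholo rho0 (rho : rep R) (ol om : bool)
    (X := Rstar rho0 `\` [set c | trfun (lam ol * mu om)%g c =
                          trfun (alpha ol om * beta ol om)%g c]) :
  is_rep rho0 -> bdry_regular rho0 ->
  Homstar rho0 rho -> rep_triple rho != 0 ->
  local_biholo_at rho0 X (trpair (lam ol) (mu om) : _ -> 'rV[C]_2) (conj_class rho).
Proof.
move=> [dr0 _] reg0 Hrho tN0; have [[rr _ _] _] := Hrho; have [dr mr] := rr.
have [W [f1 [f2 [f3 [oW W0 Wf]]]]] : exists (W : set 'rV[C]_2) (f1 f2 f3 : 'rV[C]_2 -> M2),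
  [/\ open W, W (rep_pair rho) & forall w, W w ->
    [/\ is_rep (rep3 (f1 w) (f2 w) (f3 w)),
      forall i, \tr (rep3 (f1 w) (f2 w) (f3 w) (bdry i)) = \tr (rho (bdry i)),
      rep_pair (rep3 (f1 w) (f2 w) (f3 w)) = w,
      `|rep_triple (rep3 (f1 w) (f2 w) (f3 w)) - rep_triple rho| < `|rep_triple rho| &
      [/\ differentiable f1 w, differentiable f2 w & differentiable f3 w]]].
  have tN0' := tN0; rewrite rep_tripleE// in tN0'.
  have [W [f1 [f2 [f3 [oW W0 Wf]]]]] :=
    local_section (dr gamma1) (dr gamma2) (dr gamma3) tN0'.
  exists W, f1, f2, f3; split; [exact: oW|exact: W0|move=> w /Wf[[d1 d2 d3] [t1 t2 t3 t4] tp tt df]].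
  have [e1 e2 e3] := rep3E (f1 w) (f2 w) (f3 w).
  have rr' : is_rep (rep3 (f1 w) (f2 w) (f3 w)) by exact: rep3_is_rep.
  have [dr' mr'] := rr'.
  split; [exact: rr'| | | |exact: df].
  - have e4 : rep3 (f1 w) (f2 w) (f3 w) (gamma1 * gamma2 * gamma3)%g =
        f1 w *m f2 w *m f3 w by rewrite !mr' e1 e2 e3.
    have r4 : rho (gamma1 * gamma2 * gamma3)%g =
        rho gamma1 *m rho gamma2 *m rho gamma3 by rewrite !mr.
    apply: ord4P.
    + exact: (etrans (congr1 mxtrace e1) t1).
    + exact: (etrans (congr1 mxtrace e2) t2).
    + exact: (etrans (congr1 mxtrace e3) t3).
    + exact: (etrans (congr1 mxtrace e4) (etrans t4 (congr1 mxtrace (esym r4)))).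
  - exact: (etrans (f_equal3 (@trace_pair R) e1 e2 e3) tp).
  - rewrite (rep_tripleE rr') (rep_tripleE rr).
    by rewrite (f_equal3 (fun X Y Z : M2 => triple (X *m Y) Y Z) e1 e2 e3).
pose p w := rep3 (f1 w) (f2 w) (f3 w).
(* Peripheral images have the same trace as those of [rho0] and neither is scalar, hence they are
   conjugate. *)
have pH w : W w -> Homstar rho0 (p w).
  move=> /Wf[rp tb _ tt _].
  have pN0 : rep_triple (p w) != 0.
    by apply: contraTneq tt => ->; rewrite sub0r normrN ltxx.
  split=> [|i]; first exact: good_of_triple.
  have reg := reg0 i; have [dp _] := rp.
  have [P dP PE] := @nonscalar_conj C (rho0 (bdry i)) (p w (bdry i))
    (etrans (dr0 _) (esym (dp _))) (etrans (esym (Homstar_tr i Hrho)) (esym (tb i)))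
    (fun q => @regular_nonscalar R _ q (dr0 _) reg)
    (fun q => @triple_bdry_nonscalar R _ i q rp pN0).
  by exists P.
pose U := [set conj_class (p w) | w in W].
have FU (w : 'rV[C]_2) : W w -> trpair (lam ol) (mu om) (conj_class (p w)) = w.
  by move=> /Wf[rp _ pw _ _]; rewrite trpairE.
have imU : trpair (lam ol) (mu om) @` U = W.
  apply/seteqP; split=> [_ [_ [w Ww <-] <-]|w Ww]; first by rewrite FU.
  by exists (conj_class (p w)); [exists w|exact: FU].
(* The triple products of rho' and of the section agree up to sign, and both
   are closer to that of rho than to its opposite. *)
have crit rho' : Homstar rho0 rho' -> W (rep_pair rho') ->
    `|rep_triple rho' - rep_triple rho| < `|rep_triple rho| ->
    conj_class rho' (p (rep_pair rho')).
  move=> H' W' t'; have [[r' _ _] _] := H'.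
  have [rp tb pw tt _] := Wf _ W'; rewrite -/(p _) in rp tb pw tt.
  have tb' i : \tr (rho' (bdry i)) = \tr (p (rep_pair rho') (bdry i)).
    by rewrite tb (Homstar_tr i Hrho) (Homstar_tr i H').
  have /rowP pw' := pw; have := pw' 0; have := pw' 1.
  rewrite !mxE /= => e2 e1.
  have [_ m'] := r'; have [_ mp] := rp.
  have l' : \tr (rho' (gamma1 * gamma2)%g) = \tr (p (rep_pair rho') (gamma1 * gamma2)%g).
    by rewrite m' mp.
  have h' : \tr (rho' (gamma2 * gamma3)%g) = \tr (p (rep_pair rho') (gamma2 * gamma3)%g).
    by rewrite m' mp.
  apply: (rep_rigid r' rp _ tb' l' h').
    by apply: contraTneq t' => ->; rewrite sub0r normrN ltxx.
  have /eqP := rep_triple_sqr r' rp tb' l' h'.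
  rewrite eqf_sqr => /orP[/eqP//|/eqP e].
  by rewrite e in t'; case: (near_opp tt t').
exists U, (fun w => conj_class (p w)).
have UR : U `<=` Rstar rho0 by move=> _ [w Ww <-]; exists (p w) => //; exact: pH.
split; split.
(* By [crit], coordinates in W and triple product near that of rho suffice for a class to meet the
   section; both conditions are open for pointwise convergence. *)
- split=> //; exists [set rho' | W (trace_coords rho') /\
     `|trace_gap rho' - rep_triple rho| < `|rep_triple rho|].
    apply: openI.
      by apply: open_comp oW => rho' _; exact: continuous_trace_coords.
    have oB : open [set z : C | `|z - rep_triple rho| < `|rep_triple rho|].
      rewrite [X in open X](_ : _ = ball (rep_triple rho) `|rep_triple rho|).
        by apply: ball_open; rewrite normr_gt0.
      by apply/seteqP; split=> z; rewrite -ball_normE /ball_ /= distrC.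
    by apply: open_comp oB => rho' _; exact: continuous_trace_gap.
  move=> rho' H'; have [[r' _ _] _] := H'; rewrite /= trace_coordsE// trace_gapE//.
  split=> [[w Ww pw]|[W' t']]; last first.
    by exists (rep_pair rho') => //; exact/esym/conj_class_eq/crit.
  have cc : conj_class (p w) rho' by rewrite pw; exact: conj_class_refl.
  have [rp _ pw' tt _] := Wf _ Ww; rewrite (rep_triple_conj rp cc); split=> //.
  rewrite -trace_coordsE// /trace_coords !(conj_class_tr _ cc) -/(trace_coords (p w)).
  by rewrite trace_coordsE// pw'.
- exists (rep_pair rho) => //; apply/esym/conj_class_eq/crit => //.
  by rewrite subrr normr0 normr_gt0.
- move=> _ [w Ww <-]; split; first by apply: UR; exists w.
  rewrite /= !trfunE => /eqP; rewrite -subr_eq0.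
  have [rp _ _ tt _] := Wf _ Ww; rewrite (tr_resolution _ _ rp) mulf_eq0 signr_eq0 /=.
  by move=> /eqP t0; move: tt; rewrite t0 sub0r normrN ltxx.
- by rewrite imU.
- exact: holo_on_trpair.
- rewrite imU => v Wv; exists W, p; split=> // w Ww _; split=> //; first exact: pH.
  move=> g; have [_ _ _ _ [df1 df2 df3]] := Wf _ Ww.
  apply: (@differentiable_word _ (fun w i => nth 0 [:: f1 w; f2 w; f3 w] i)).
  by apply: ord3P; [exact: df1|exact: df2|exact: df3].
- by move=> _ [w Ww <-]; rewrite FU.
Qed.

Lemma conj_class_Homstar rho0 rho : Rstar rho0 (conj_class rho) ->
  exists2 rho', Homstar rho0 rho' & conj_class rho' rho.
Proof.
by case=> rho' H' e; exists rho' => //; rewrite e; exact: conj_class_refl.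
Qed.

End Main.

Theorem proposition44 (R : realType) (ol om : bool) (rho0 : rep R)
    (hgood : good rho0) (hreg : bdry_regular rho0)
    (hne : \tr (rho0 (lam ol * mu om)%g) <>
           \tr (rho0 (alpha ol om * beta ol om)%g)) :
  let l := lam ol in
  let m := mu om in
  let X := Rstar rho0 `\`
    [set c | trfun (l * m)%g c = trfun (alpha ol om * beta ol om)%g c] in
  local_parameterization rho0 X (trpair l m) /\
  exists eps : Cx R, (eps = 1 \/ eps = -1) /\
    forall (rho : rep R) (u v : pi1 -> 'M[Cx R]_2),
      X (conj_class rho) -> tangent rho u -> tangent rho v ->
      omega rho u v =
        eps * ((dtr l rho u * dtr m rho v - dtr l rho v * dtr m rho u) /
               (trfun (l * m)%g (conj_class rho) -
                trfun (alpha ol om * beta ol om)%g (conj_class rho))).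
Proof.
move=> l m X.
have XE (rho : rep R) : is_rep rho -> trfun (l * m)%g (conj_class rho) -
    trfun (alpha ol om * beta ol om)%g (conj_class rho) =
    (-1) ^+ (ol (+) om) * rep_triple rho.
  by move=> rr; rewrite !trfunE; exact: tr_resolution.
have tN0 (rho : rep R) : is_rep rho -> X (conj_class rho) -> rep_triple rho != 0.
  move=> rr [_ /eqP]; rewrite -subr_eq0 (XE _ rr) mulf_eq0 negb_or.
  by move=> /andP[].
split.
  split=> [|x Xx]; first exact: holo_on_trpair.
  have [[rho Hrho e] _] := Xx; rewrite -e in Xx *.
  have [[rr _ _] _] := Hrho; have [r0 _ _] := hgood.
  exact: local_biholo r0 hreg Hrho (tN0 _ rr Xx).
(* Reversing one curve changes the sign of the denominator but neither of the two traces. *)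
exists ((-1) ^+ (ol (+) om)); split.
  by case: (ol (+) om); [right; rewrite expr1|left; rewrite expr0].
move=> rho u v Xrho tu tv.
have [rho' [[rr' _ _] _] cc] := conj_class_Homstar Xrho.1.
have rr := conj_class_rep rr' cc; have t0 := tN0 _ rr Xrho.
(* The default of [xget] is never taken: u with its own peripheral cochains is a lift. *)
have lift_u : lifts rho u (xget (cst 0, cst 0) (lifts rho u)).
  have [zu bu] := tu.
  have /choice[x xP] i : exists Y, \tr Y = 0 /\
      forall g, bdry_group i g -> u g = cobound rho Y g.
    by have [Y tY uY] := bu i; exists Y.
  apply: (@xgetI _ _ _ (u, x)); split; first by split.
  by exists 0 => [|g]; rewrite ?raddf0 // /cobound /Ad mulmx0 mul0mx subrr addr0.
have [zu _] := tu; have [zv _] := tv.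
rewrite /omega (pairing_lift rr t0 tu tv lift_u) (XE _ rr).
rewrite (dtr_lam ol rr zu) (dtr_lam ol rr zv) (dtr_mu om rr zu) (dtr_mu om rr zv).
rewrite (dtr_lam false rr zu) (dtr_lam false rr zv) (dtr_mu false rr zu)
  (dtr_mu false rr zv).
move: (rep_triple rho) (_ * _ - _ * _) => t w.
case: (ol (+) om); first by rewrite expr1 !mulN1r invrN mulrN opprK.
by rewrite expr0 !mul1r.
Qed.
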